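(* Let $X$ be a complete metric space and $E\subset X$ a $1$-rectifiable subset with $\mathcal{H}^1(E)<\infty$. Then the set \[\{f\in\textnormal{Lip}_1(X,\mathbb{R}):\int_EJ_Ef\,\mathrm{d}\mathcal{H}^1=\mathcal{H}^1(E)\}\] is residual in $\textnormal{Lip}_1(X,\mathbb{R})$. In particular, a typical $f\in\textnormal{Lip}_1(X,\mathbb{R})$ satisfies $J_Ef=1$ $\mathcal{H}^1$-a.e. in $E$.
   Context: $\textnormal{Lip}_1(X,\mathbb{R})$: bounded $1$-Lipschitz functions with the supremum metric; residual = contains a countable intersection of open dense sets; ''typical'' = the set of elements with the property is residual. $\mathcal{H}^1(A)=\sup_\delta\inf\sum\operatorname{diam}A_i$. $1$-rectifiable: $\mathcal{H}^1$-measurable and covered up to a null set by countably many Lipschitz images of subsets of $\mathbb{R}$. $J_Ef(x)=|(f\circ I)'(I^{-1}x)|/|I'|(I^{-1}x)$ for $\mathcal{H}^1$-a.e. $x\in E$, for any biLipschitz bijection $I\colon\widetilde F\subset\mathbb{R}\to\widetilde E\subset E$ with $x$ a density point of $\widetilde E$, where $(f\circ I)'$ is the approximate derivative and $|I'|(u)=\lim_{v\to u,v\in\widetilde F}d(I(v),I(u))/|v-u|$ is the metric derivative (assumed positive). *)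

(* Defs.v *)
From HB Require Import structures.
From mathcomp Require Import all_boot all_order all_algebra.
From mathcomp Require Import all_classical all_reals all_analysis.
Set Implicit Arguments. Unset Strict Implicit. Unset Printing Implicit Defensive.
Import Order.TTheory GRing.Theory Num.Theory.
Import numFieldNormedType.Exports.
Local Open Scope classical_set_scope.
Local Open Scope ring_scope.

Section Defs.
Variables (R : realType) (X : Type).

Definition is_metric (d : X -> X -> R) : Prop :=
  (forall x y, d x y = 0 <-> x = y) /\
  (forall x y, d x y = d y x) /\
  (forall x y z, d x z <= d x y + d y z).

Definition complete_metric (d : X -> X -> R) : Prop :=
  forall u : nat -> X,
    (forall eps : R, 0 < eps -> exists N : nat, forall m n : nat,
        (N <= m)%N -> (N <= n)%N -> d (u m) (u n) < eps) ->
    exists l : X, forall eps : R, 0 < eps -> exists N : nat, forall n : nat,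
        (N <= n)%N -> d (u n) l < eps.

(** diameter (diam of the empty set is 0) *)
Definition diam (d : X -> X -> R) (A : set X) : \bar R :=
  ereal_sup ([set 0%E] `|` [set z | exists x y, A x /\ A y /\ z = (d x y)%:E]).

Definition H1delta (d : X -> X -> R) (delta : R) (A : set X) : \bar R :=
  ereal_inf [set s | exists C : nat -> set X,
    A `<=` \bigcup_i C i /\ (forall i, (diam d (C i) <= delta%:E)%E) /\
    s = (\sum_(0 <= i <oo) diam d (C i))%E].

Definition H1 (d : X -> X -> R) (A : set X) : \bar R :=
  ereal_sup [set H1delta d delta A | delta in [set delta : R | 0 < delta]].

Definition H1_measurable (d : X -> X -> R) (A : set X) : Prop :=
  forall T : set X, H1 d T = (H1 d (T `&` A) + H1 d (T `&` ~` A))%E.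

End Defs.

Definition dR (R : realType) (x y : R) : R := `|x - y|.

Section Defs2.
Variables (R : realType) (X : Type) (d : X -> X -> R).

Definition rectifiable1 (E : set X) : Prop :=
  H1_measurable d E /\
  exists (A : nat -> set R) (g : nat -> R -> X),
    (forall i, exists L : R, forall u v, A i u -> A i v ->
        d (g i u) (g i v) <= L * `|u - v|) /\
    H1 d (E `\` \bigcup_i (g i @` A i)) = 0%E.

Definition Lip1 : set (X -> R) :=
  [set f | (exists M : R, forall x, `|f x| <= M) /\
           (forall x y, `|f x - f y| <= d x y)].

Definition supdist (f g : X -> R) : \bar R :=
  ereal_sup (range (fun x => (`|f x - g x|)%:E)).

Definition open_in_Lip1 (U : set (X -> R)) : Prop :=
  U `<=` Lip1 /\
  forall f, U f -> exists r : R, 0 < r /\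
    forall g, Lip1 g -> (supdist f g < r%:E)%E -> U g.

Definition dense_in_Lip1 (U : set (X -> R)) : Prop :=
  forall f, Lip1 f -> forall r : R, 0 < r ->
    exists g, U g /\ (supdist f g < r%:E)%E.

Definition residual_in_Lip1 (S : set (X -> R)) : Prop :=
  exists U : nat -> set (X -> R),
    (forall n, open_in_Lip1 (U n) /\ dense_in_Lip1 (U n)) /\
    Lip1 `&` \bigcap_n U n `<=` S.

Definition density_point (A : set X) (x : X) : Prop :=
  forall eps : R, 0 < eps -> exists delta : R, 0 < delta /\
    forall r : R, 0 < r -> r < delta ->
      (((2 - eps) * r)%:E <= H1 d (A `&` [set y | (d x y < r)%R]) <=
       ((2 + eps) * r)%:E)%E.

Definition biLip_bij (F : set R) (Et : set X) (I : R -> X) : Prop :=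
  I @` F = Et /\
  exists L : R, 0 < L /\ forall u v, F u -> F v ->
    `|u - v| / L <= d (I u) (I v) /\ d (I u) (I v) <= L * `|u - v|.

(** approximate derivative of g : F -> R at u equals D: for every eps > 0
    the set of points where the difference quotient is eps-far from D,
    together with the complement of F, has Lebesgue density 0 at u
    (Lebesgue outer measure = H^1 on R) *)
Definition approx_deriv (g : R -> R) (F : set R) (u D : R) : Prop :=
  forall eps : R, 0 < eps -> exists delta : R, 0 < delta /\
    forall r : R, 0 < r -> r < delta ->
      (H1 (@dR R) (([set v | ~ F v] `|`
          [set v | F v /\ v <> u /\ (eps < `|(g v - g u) / (v - u) - D|)%R])
         `&` [set v | (`|v - u| < r)%R]) <= (eps * r)%:E)%E.

Definition metric_deriv (I : R -> X) (F : set R) (u m : R) : Prop :=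
  forall eps : R, 0 < eps -> exists delta : R, 0 < delta /\
    forall v, F v -> v <> u -> `|v - u| < delta ->
      `|d (I v) (I u) / `|v - u| - m| < eps.

(** J_E f (x) = |(f o I)'(I^-1 x)| / |I'|(I^-1 x) for some biLipschitz
    I : F -> Et subset E with x a density point of Et (0 if no such I) *)
Definition JE (E : set X) (f : X -> R) (x : X) : R :=
  xget 0 [set j : R | exists (F : set R) (Et : set X) (I : R -> X),
    biLip_bij F Et I /\ Et `<=` E /\ density_point Et x /\
    exists u : R, F u /\ I u = x /\
    exists D m : R, approx_deriv (f \o I) F u D /\ metric_deriv I F u m /\
      0 < m /\ j = `|D| / m].

End Defs2.

(* Main.v *)
(* Elementary proof, without Rademacher's theorem or metric differentials.

   A 1-Lipschitz function on a piece of a rectifiable curve which increases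
   almost as fast as the arc length is, by a Vitali covering argument applied to
   the monotone difference, [(1 - lam)]-expanding off a set of small measure
   ([H1_nonexpanding_part]).  For the distance functions to the vertices of an
   inscribed polygon of almost maximal length this splits [E], up to small
   measure, into pieces on which some distance function is almost isometric.

   For [theta > 0], the functions [g] that increase at unit speed, up to a total
   error less than [theta], on finitely many pieces covering [E] up to measure
   [theta] form an open set, because the error of each piece is stable under
   uniform perturbation and there are finitely many.  It is dense: after shrinking
   a given [f] to [(1 - eps) * f], take [g x = min_p ((1 - eps) * f p + d x p)] over
   a fine finite net of points [p] of the almost isometric pieces; where the
   minimum is attained at [p], [g] is a distance function up to a constant.

   A function [g] in all these open sets is, off a null set, asymptotically
   isometric along closed pieces [S] of [E] on which it is bi-Lipschitz.  The
   inverse of [g] on [S] is a chart with both derivatives equal to [1]; and since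
   [E `\` S] has density [0] at almost every point of [S], any other chart meets
   [S] arbitrarily close to such a point, so it gives the same Jacobian. *)
Require Import Defs.
From HB Require Import structures.
From mathcomp Require Import all_boot all_order all_algebra.
From mathcomp Require Import all_classical all_reals all_analysis.
From mathcomp Require Import ring lra.
Import Order.TTheory GRing.Theory Num.Theory.
Import numFieldNormedType.Exports.
Local Open Scope classical_set_scope.
Local Open Scope ring_scope.

Set Implicit Arguments. Unset Strict Implicit. Unset Printing Implicit Defensive.

(** * The one-dimensional Hausdorff outer measure of a metric *)

Section HausdorffOuterMeasure.
Variables (R : realType) (X : Type) (d : X -> X -> R).
Hypothesis hd : is_metric d.

Lemma metric_refl x : d x x = 0.
Proof. by case: hd => h _; apply/h. Qed.

Lemma metric_eq0 x y : d x y = 0 -> x = y.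
Proof. by case: hd => h _ /h. Qed.

Lemma metric_sym x y : d x y = d y x.
Proof. by case: hd => _ [h _]. Qed.

Lemma metric_tri z x y : d x y <= d x z + d z y.
Proof. by case: hd => _ [_ h]. Qed.

Lemma metric_ge0 x y : 0 <= d x y.
Proof.
have := metric_tri y x x; rewrite metric_refl (metric_sym y x).
by move=> h; lra.
Qed.

Lemma metric_lip p x y : `|d x p - d y p| <= d x y.
Proof.
have h1 := metric_tri y x p; have h2 := metric_tri x y p.
have h3 := metric_sym y x.
by rewrite ler_norml; apply/andP; split; lra.
Qed.

Lemma diam_ge0 (A : set X) : (0 <= diam d A)%E.
Proof. by apply: ereal_sup_ubound; left. Qed.

Lemma diam_le (A : set X) (c : \bar R) : (0 <= c)%E ->
  (forall x y, A x -> A y -> ((d x y)%:E <= c)%E) -> (diam d A <= c)%E.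
Proof.
move=> c0 h; apply: ge_ereal_sup => z [->//|[x [y [Ax [Ay ->]]]]].
exact: h.
Qed.

Lemma le_diam (A : set X) x y : A x -> A y -> ((d x y)%:E <= diam d A)%E.
Proof. by move=> Ax Ay; apply: ereal_sup_ubound; right; exists x, y. Qed.

Lemma H1delta_ge0 delta (A : set X) : (0 <= H1delta d delta A)%E.
Proof.
apply: le_ereal_inf_tmp => s [C [_ [_ ->]]].
by apply: nneseries_ge0 => n _ _; exact: diam_ge0.
Qed.

Lemma H1delta_le_H1 delta (A : set X) : 0 < delta ->
  (H1delta d delta A <= H1 d A)%E.
Proof. by move=> h; apply: ereal_sup_ubound; exists delta. Qed.

Lemma H1_ge0 (A : set X) : (0 <= H1 d A)%E.
Proof. exact: le_trans (H1delta_ge0 1 A) (H1delta_le_H1 A ltr01). Qed.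

Lemma H1_le (A : set X) c :
  (forall delta, 0 < delta -> (H1delta d delta A <= c)%E) -> (H1 d A <= c)%E.
Proof. by move=> h; apply: ge_ereal_sup => _ [delta h0 <-]; exact: h. Qed.

Lemma H1delta_le_cover delta (A : set X) (C : nat -> set X) :
  A `<=` \bigcup_i C i -> (forall i, (diam d (C i) <= delta%:E)%E) ->
  (H1delta d delta A <= \sum_(0 <= i <oo) diam d (C i))%E.
Proof. by move=> AC Cd; apply: ereal_inf_lbound; exists C. Qed.

Lemma H1_cover delta eps (A : set X) : 0 < delta -> 0 < eps ->
  (H1 d A < +oo)%E -> exists C : nat -> set X,
  [/\ A `<=` \bigcup_i C i, (forall i, (diam d (C i) <= delta%:E)%E) &
    (\sum_(0 <= i <oo) diam d (C i) <= H1 d A + eps%:E)%E].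
Proof.
move=> d0 e0 Afin.
have Dfin : H1delta d delta A \is a fin_num.
  rewrite ge0_fin_numE ?H1delta_ge0//.
  exact: le_lt_trans (H1delta_le_H1 A d0) Afin.
have [s [C [AC [Cd ->]]] sA] := lb_ereal_inf_adherent e0 Dfin.
exists C; split => //; apply: (le_trans (ltW sA)).
by rewrite leeD2r// H1delta_le_H1.
Qed.

Lemma le_H1 (A B : set X) : A `<=` B -> (H1 d A <= H1 d B)%E.
Proof.
move=> AB; apply: H1_le => delta d0; apply: le_trans (H1delta_le_H1 B d0).
apply: le_ereal_inf_tmp => s [C [BC [Cd ->]]].
by apply: H1delta_le_cover => //; exact: subset_trans BC.
Qed.

Lemma H1_set0 : H1 d set0 = 0%E.
Proof.
apply/eqP; rewrite eq_le H1_ge0 andbT; apply: H1_le => delta d0.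
apply: (@le_trans _ _ (\sum_(0 <= i <oo) diam d set0)%E).
  apply: H1delta_le_cover => // i; apply: diam_le => //.
  by rewrite lee_fin ltW.
rewrite eseries0// => i _ _; apply/eqP; rewrite eq_le diam_ge0 andbT.
exact: diam_le.
Qed.

(** Each [A n] gets a cover optimal up to [e / (2 ^ n.+1)%:R]; a bijection of [nat] with pairs
    enumerates the doubly indexed cover of the union. *)
Lemma H1_bigcup_le (A : nat -> set X) :
  (H1 d (\bigcup_n A n) <= \sum_(0 <= n <oo) H1 d (A n))%E.
Proof.
have [[i ioo]|] := pselect (exists i, H1 d (A i) = +oo%E).
  rewrite (eseries_pinfty _ _ ioo) ?leey// => n _.
  by rewrite -ltNye (lt_le_trans _ (H1_ge0 _)).
rewrite -forallNE => Aoo; apply/lee_addgt0Pr => e e0.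
rewrite (le_trans _ (epsilon_trick xpredT _ (ltW e0)))//; last first.
  by move=> n; exact: H1_ge0.
apply: H1_le => delta d0.
have /choice[G PG] : forall n, exists C : nat -> set X,
  [/\ A n `<=` \bigcup_i C i, (forall i, (diam d (C i) <= delta%:E)%E) &
    (\sum_(0 <= i <oo) diam d (C i) <= H1 d (A n) + (e / (2 ^ n.+1)%:R)%:E)%E].
  move=> n; apply: H1_cover => //; first by rewrite divr_gt0// ltr0n expn_gt0.
  by rewrite ltey; apply/eqP; exact: Aoo.
have /card_esym/ppcard_eqP[f] := card_nat2.
pose D (p : nat * nat) := G p.1 p.2.
have D0 p : (0 <= (diam d \o D) p)%E by exact: diam_ge0.
apply: (@le_trans _ _ (\esum_(i in setT) diam d (D i))%E).
  apply: (@le_trans _ _ (\sum_(0 <= i <oo) diam d (D (f i)))%E).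
    apply: H1delta_le_cover.
      move=> t [i _ /=]; have [h _ _] := PG i => /h[j _ Gt].
      by exists (f^-1%FUN (i, j)) => //=; rewrite /D invK ?inE.
    by move=> i; have [_ h _] := PG (f i).1; exact: h.
  rewrite -(esum_pred_image (diam d \o D) _ xpredT) ?[fun=> _]set_true//.
  by rewrite image_eq.
rewrite [leLHS](_ : _ =
    (\sum_(0 <= i <oo) \sum_(0 <= j <oo) diam d (G i j))%E); last first.
  pose J : nat -> set (nat * nat) := fun i => [set (i, j) | j in setT].
  rewrite [X in esum X _](_ : _ = \bigcup_k J k); last first.
    by rewrite predeqE => -[a b]; split => // _; exists a => //; exists b.
  rewrite esum_bigcupT /=; last 2 first.
    - apply/trivIsetP => i j _ _ ij.
      rewrite predeqE => -[n m] /=; split => //= -[] [_] _ [<-{n} _].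
      by move=> [m' _] [] /esym/eqP; rewrite (negbTE ij).
    - by move=> p; exact: diam_ge0.
  rewrite -nneseries_esumT; last first.
    by move=> n; apply: esum_ge0 => x _; exact: diam_ge0.
  apply: eq_eseriesr => i _; rewrite nneseries_esumT//.
  rewrite (@reindex_esum _ _ _ setT (J i) (fun j => (i, j)))//.
    by split => // [j _|x y _ _ []//]; exists j.
  by move=> j; exact: diam_ge0.
apply: lee_nneseries.
  by move=> i _ _; apply: nneseries_ge0 => n _ _; exact: diam_ge0.
by move=> n _; have [_ _] := PG n.
Qed.

Lemma H1_sub_bigcup_le (B : set X) (A : nat -> set X) :
  B `<=` \bigcup_n A n -> (H1 d B <= \sum_(0 <= n <oo) H1 d (A n))%E.
Proof. by move=> BA; apply: le_trans (H1_bigcup_le A); exact: le_H1. Qed.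

Lemma H1U_le (A B : set X) : (H1 d (A `|` B) <= H1 d A + H1 d B)%E.
Proof.
pose F n := if n is 0%N then A else if n is 1%N then B else set0.
have h : A `|` B `<=` \bigcup_n F n.
  by move=> x [Ax|Bx]; [exists 0%N|exists 1%N].
apply: (le_trans (H1_sub_bigcup_le h)).
rewrite (nneseries_split 0 2); last by move=> k _; exact: H1_ge0.
rewrite eseries0 ?adde0; first by rewrite big_mkord big_ord_recl big_ord1.
by case=> [|[|n]]//= _ _; rewrite H1_set0.
Qed.

Lemma H1_sub_le (A B C : set X) : A `<=` B `|` C ->
  (H1 d A <= H1 d B + H1 d C)%E.
Proof. by move=> /le_H1 h; apply: le_trans h (H1U_le _ _). Qed.

Lemma H1_null_bigcup (A : nat -> set X) :
  (forall n, H1 d (A n) = 0%E) -> H1 d (\bigcup_n A n) = 0%E.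
Proof.
move=> A0; apply/eqP; rewrite eq_le H1_ge0 andbT.
by apply: (le_trans (H1_bigcup_le A)); rewrite eseries0.
Qed.

Lemma H1_null_sub (A B : set X) : A `<=` B -> H1 d B = 0%E -> H1 d A = 0%E.
Proof.
by move=> /le_H1 h B0; apply/eqP; rewrite eq_le H1_ge0 andbT -B0.
Qed.

Lemma H1_nullP (A : set X) :
  (forall e, 0 < e -> (H1 d A <= e%:E)%E) -> H1 d A = 0%E.
Proof.
move=> h; apply/eqP; rewrite eq_le H1_ge0 andbT.
by apply/lee_addgt0Pr => e e0; rewrite add0e; exact: h.
Qed.

Lemma H1_null_dist0 (A : set X) : (forall x y, A x -> A y -> x = y) ->
  H1 d A = 0%E.
Proof.
move=> A1; apply: H1_nullP => e e0; apply: H1_le => delta d0.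
pose C n := if n is 0%N then A else set0.
have D0 n : diam d (C n) = 0%E.
  apply/eqP; rewrite eq_le diam_ge0 andbT; apply: diam_le => // x y.
  by case: n => [|n]//= Ax Ay; rewrite (A1 x y)// metric_refl.
apply: (@le_trans _ _ (\sum_(0 <= i <oo) diam d (C i))%E).
  apply: H1delta_le_cover; first by move=> x Ax; exists 0%N.
  by move=> i; rewrite D0 lee_fin ltW.
by rewrite eseries0 ?lee_fin ?ltW.
Qed.

End HausdorffOuterMeasure.

(** * Hausdorff measure of Lipschitz images *)

Section LipschitzImage.
Variables (R : realType) (T X Y : Type) (d : X -> X -> R) (dY : Y -> Y -> R).

(** The Lipschitz map from the image of [tau] to that of [gam] is given through a common parameter
    set [T]. This covers curves compared with their arc length as well as inverses of injective
    functions, with no inverse to construct. *)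
Lemma H1_lip_image (P : set T) (gam : T -> X) (tau : T -> Y) (L : R) : 0 < L ->
  (forall s t, P s -> P t -> d (gam s) (gam t) <= L * dY (tau s) (tau t)) ->
  (H1 d (gam @` P) <= L%:E * H1 dY (tau @` P))%E.
Proof.
move=> L0 lip; have L0' : (0 <= L%:E)%E by rewrite lee_fin ltW.
have [Yoo|Yfin] := eqVneq (H1 dY (tau @` P)) +oo%E.
  by rewrite Yoo gt0_muley ?leey// lte_fin.
have {}Yfin : (H1 dY (tau @` P) < +oo)%E by rewrite ltey.
apply/lee_addgt0Pr => e e0; apply: H1_le => delta d0.
have dL : 0 < delta / L by rewrite divr_gt0.
have eL : 0 < e / L by rewrite divr_gt0.
have [C [PC Cd Cs]] := H1_cover dL eL Yfin.
pose D n := gam @` (P `&` tau @^-1` C n).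
have DC n : (diam d (D n) <= L%:E * diam dY (C n))%E.
  apply: diam_le; first by rewrite mule_ge0// diam_ge0.
  move=> _ _ [s [Ps Cs'] <-] [t [Pt Ct] <-].
  apply: (@le_trans _ _ (L%:E * (dY (tau s) (tau t))%:E)%E).
    by rewrite -EFinM lee_fin lip.
  by rewrite lee_wpmul2l// le_diam.
apply: (@le_trans _ _ (\sum_(0 <= i <oo) diam d (D i))%E).
  apply: H1delta_le_cover.
    move=> _ [s Ps <-]; have [i _ Ci] : (\bigcup_i C i) (tau s).
      by apply: PC; exists s.
    by exists i => //; exists s.
  move=> i; apply: (le_trans (DC i)).
  apply: (@le_trans _ _ (L%:E * (delta / L)%:E)%E).
    by rewrite lee_wpmul2l.
  by rewrite -EFinM mulrCA divff ?mulr1// gt_eqF.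
apply: (@le_trans _ _ (\sum_(0 <= i <oo) (L%:E * diam dY (C i)))%E).
  by apply: lee_nneseries => // n _ _; exact: diam_ge0.
rewrite nneseriesZl; last by move=> i _; exact: diam_ge0.
apply: (@le_trans _ _ (L%:E * (H1 dY (tau @` P) + (e / L)%:E))%E).
  by rewrite lee_wpmul2l.
rewrite ge0_muleDr ?H1_ge0//; last by rewrite lee_fin ltW.
by rewrite -EFinM mulrCA divff ?mulr1// gt_eqF.
Qed.

End LipschitzImage.

(** * Limits and nonnegative series *)

Section Limits.
Variable R : realType.

Lemma ex_natSinv_lt (e : R) : 0 < e -> exists N : nat, N.+1%:R^-1 < e.
Proof.
move=> e0; have [N _ h] := near_infty_natSinv_lt (PosNum e0).
by exists N; apply: h => /=.
Qed.

Lemma natSinv_gt0 (n : nat) : 0 < n.+1%:R^-1 :> R.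
Proof. by rewrite invr_gt0 ltr0n. Qed.

Lemma natSinv_le (m n : nat) : (m <= n)%N -> n.+1%:R^-1 <= m.+1%:R^-1 :> R.
Proof. by move=> mn; rewrite lef_pV2 ?posrE ?ltr0n// ler_nat. Qed.

Lemma cvge_ltP (u : nat -> \bar R) (l : \bar R) (c : \bar R) :
  u n @[n --> \oo] --> l -> (l < c)%E ->
  exists N, forall n, (N <= n)%N -> (u n < c)%E.
Proof.
move=> ul lc; have [N _ h] : \forall n \near \oo, (u n < c)%E.
  by apply: (ul [set x | (x < c)%E]); exact: open_ereal_lt'.
by exists N => n Nn; exact: h.
Qed.

Lemma nneseries_le_partial (u : nat -> \bar R) (c : \bar R) :
  (forall i, (0 <= u i)%E) ->
  (forall n, (\sum_(0 <= i < n) u i <= c)%E) -> (\sum_(0 <= i <oo) u i <= c)%E.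
Proof.
move=> u0 h; apply: lime_le; first exact: is_cvg_nneseries.
by apply: nearW.
Qed.

Lemma nneseries_le_half (u : nat -> \bar R) (e : R) : 0 < e ->
  (forall i, (0 <= u i)%E) -> (forall i, (u i <= (e / (2 ^ i.+1)%:R)%:E)%E) ->
  (\sum_(0 <= i <oo) u i <= e%:E)%E.
Proof.
move=> e0 u0 ue.
have := @epsilon_trick R (fun=> 0%E) e xpredT (fun=> lexx _) (ltW e0).
rewrite [X in (_ <= X + _)%E]eseries0// add0e; apply: le_trans.
by apply: lee_nneseries => // i _; rewrite add0e.
Qed.

Lemma series_measure_bigcup (disp : measure_display) (T : measurableType disp)
    (m : {measure set T -> \bar R}) (F : nat -> set T) :
  (forall n, measurable (F n)) -> trivIset setT F ->
  (\sum_(0 <= n <oo) m (F n) = m (\bigcup_n F n))%E.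
Proof.
move=> mF tF; rewrite measure_bigcup//.
by apply/congr_lim/funext => n; apply: eq_bigl => i; rewrite in_setT.
Qed.

End Limits.

(** * Closed sets and Carathéodory measurability *)

Section ClosedSets.
Variables (R : realType) (X : Type) (d : X -> X -> R).
Hypothesis hd : is_metric d.

(** [X] carries no topology, so closedness is phrased with [d] alone. *)
Definition mclosed (C : set X) : Prop :=
  forall x, (forall e, 0 < e -> exists2 y, C y & d x y < e) -> C x.

Definition mball (x : X) (r : R) : set X := [set y | d x y < r].

(** Closed sets at positive distance from [C]; they increase with [n] and exhaust the complement of
    [C] when [C] is closed. *)
Definition far (C : set X) (n : nat) : set X :=
  [set x | forall y, C y -> n.+1%:R^-1 <= d x y].

Lemma mclosedN (C : set X) x : mclosed C -> ~ C x -> exists n, far C n x.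
Proof.
move=> cC; apply: contra_notP => /forallNP h; apply: cC => e e0.
have [n ne] := ex_natSinv_lt e0.
have /existsNP[y /not_implyP[Cy /negP]] := h n.
by rewrite -ltNge => ?; exists y => //; apply: lt_trans ne.
Qed.

Lemma farN (C : set X) n : far C n `<=` ~` C.
Proof.
by move=> x /(_ x) h /h; rewrite metric_refl// leNgt natSinv_gt0.
Qed.

Lemma far_mono (C : set X) m n : (m <= n)%N -> far C m `<=` far C n.
Proof.
by move=> mn x h y /h; apply: le_trans; exact: natSinv_le.
Qed.

Lemma far_closed (C : set X) n : mclosed (far C n).
Proof.
move=> x h y Cy; rewrite leNgt; apply/negP => xy.
have [|z fz xz] := h (n.+1%:R^-1 - d x y); first by rewrite subr_gt0.
have := fz _ Cy; have := metric_tri hd x z y; rewrite (metric_sym hd z x).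
by move: xz; move: (n.+1%:R^-1 : R) => a; lra.
Qed.

Lemma mclosedI (A B : set X) : mclosed A -> mclosed B -> mclosed (A `&` B).
Proof.
by move=> cA cB x h; split; [apply: cA|apply: cB] => e /h[y [Ay By] ?]; exists y.
Qed.

Lemma mclosed_bigcap (A : nat -> set X) : (forall n, mclosed (A n)) ->
  mclosed (\bigcap_n A n).
Proof.
by move=> cA x h n _; apply: cA => e /h[y Ay ?]; exists y => //; exact: Ay.
Qed.

Lemma mclosedU (A B : set X) : mclosed A -> mclosed B -> mclosed (A `|` B).
Proof.
move=> cA cB x h; apply: contrapT => /not_orP[/(mclosedN cA)[n fn] /(mclosedN cB)[m fm]].
have [|y AB xy] := h (minn (maxn n m) (maxn n m)).+1%:R^-1.
  exact: natSinv_gt0.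
rewrite minnn in xy; case: AB => [/fn|/fm]; apply/negP; rewrite -ltNge.
- by apply: (lt_le_trans xy); apply: natSinv_le; exact: leq_maxl.
- by apply: (lt_le_trans xy); apply: natSinv_le; exact: leq_maxr.
Qed.

Definition mclosure (C : set X) : set X :=
  [set x | forall e, 0 < e -> exists2 y, C y & d x y < e].

Lemma sub_mclosure C : C `<=` mclosure C.
Proof. by move=> x Cx e e0; exists x; rewrite ?metric_refl. Qed.

Lemma mclosure_closed C : mclosed (mclosure C).
Proof.
move=> x h e e0; have e20 : 0 < e / 2 by lra.
have [y /(_ _ e20)[z Cz yz] xy] := h _ e20; exists z => //.
by have := metric_tri hd y x z; lra.
Qed.

(** A cover by sets of diameter at most [rho / 2] splits into a cover of [A] and one of [B], as no
    member meets both. *)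
Lemma H1_sep (A B : set X) (rho : R) : 0 < rho ->
  (forall x y, A x -> B y -> rho <= d x y) ->
  (H1 d A + H1 d B <= H1 d (A `|` B))%E.
Proof.
move=> rho0 sepAB.
have [->|ABfin] := eqVneq (H1 d (A `|` B)) +oo%E; first by rewrite leey.
have {}ABfin : (H1 d (A `|` B) < +oo)%E by rewrite ltey.
have fin S : S `<=` A `|` B -> forall de, 0 < de -> H1delta d de S \is a fin_num.
  move=> SAB de de0; rewrite ge0_fin_numE ?H1delta_ge0//.
  by apply: le_lt_trans ABfin; apply: le_trans (le_H1 _ SAB); exact: H1delta_le_H1.
have finH S : S `<=` A `|` B -> H1 d S \is a fin_num.
  move=> SAB; rewrite ge0_fin_numE ?H1_ge0//.
  by apply: le_lt_trans ABfin; exact: le_H1.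
have sA : A `<=` A `|` B by exact: subsetUl.
have sB : B `<=` A `|` B by exact: subsetUr.
(* Independent scales allow the two suprema to be taken one after the other. *)
suff main de1 de2 : 0 < de1 -> 0 < de2 ->
    (H1delta d de1 A + H1delta d de2 B <= H1 d (A `|` B))%E.
  rewrite -leeBrDr ?finH//; apply: H1_le => de1 de10.
  rewrite leeBrDr ?finH// addeC -leeBrDr ?fin//; apply: H1_le => de2 de20.
  by rewrite leeBrDr ?fin// addeC main.
move=> de10 de20; apply/lee_addgt0Pr => e e0.
pose de := Num.min (Num.min de1 de2) (rho / 2).
have de0 : 0 < de by rewrite !lt_min de10 de20 divr_gt0.
have [C [ABC Cd Cs]] := H1_cover de0 e0 ABfin.
apply: le_trans Cs.
apply: (@le_trans _ _ (\sum_(0 <= i <oo) diam d (C i `&` A) +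
                      \sum_(0 <= i <oo) diam d (C i `&` B))%E).
  have mono S i : (diam d (C i `&` S) <= de%:E)%E.
    apply: le_trans (Cd i); apply: diam_le; first exact: diam_ge0.
    by move=> x y [Cx _] [Cy _]; exact: le_diam.
  apply: leeD; apply: H1delta_le_cover.
  - by move=> x Ax; have [i _ Ci] := ABC _ (sA _ Ax); exists i.
  - move=> i; apply: le_trans (mono _ i) _.
    by rewrite lee_fin !ge_min lexx.
  - by move=> x Bx; have [i _ Ci] := ABC _ (sB _ Bx); exists i.
  - move=> i; apply: le_trans (mono _ i) _.
    by rewrite lee_fin !ge_min lexx orbT.
rewrite -nneseriesD; try by move=> *; exact: diam_ge0.
apply: lee_nneseries => [i _ _|i _]; first by rewrite adde_ge0 ?diam_ge0.
have d0 S : ~ (exists x, S x) -> diam d S = 0%E.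
  move=> S0; apply/eqP; rewrite eq_le diam_ge0 andbT; apply: diam_le => // x y Sx.
  by exfalso; apply: S0; exists x.
have mono S : (diam d (C i `&` S) <= diam d (C i))%E.
  apply: diam_le; first exact: diam_ge0.
  by move=> x y [Cx _] [Cy _]; exact: le_diam.
have [[x [Cx Ax]]|/d0 ->] := pselect (exists x, (C i `&` A) x); last by rewrite add0e.
have [[y [Cy By]]|/d0 ->] := pselect (exists y, (C i `&` B) y); last by rewrite adde0.
exfalso; have := le_trans (le_diam d Cx Cy) (Cd i).
rewrite lee_fin => xy; have := sepAB _ _ Ax By.
have : de <= rho / 2 by rewrite ge_min lexx orbT.
lra.
Qed.

(** Sets are added one at a time, so the gap only has to separate [A n] from the earlier sets and
    may tend to [0]. *)
Lemma H1_sep_series (A : nat -> set X) (rho : nat -> R) :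
  (forall n, 0 < rho n) ->
  (forall n k x y, (k < n)%N -> A k x -> A n y -> rho n <= d x y) ->
  (\sum_(0 <= k <oo) H1 d (A k) <= H1 d (\bigcup_k A k))%E.
Proof.
move=> rho0 sepA; apply: nneseries_le_partial; first by move=> i; exact: H1_ge0.
move=> n; apply: (@le_trans _ _ (H1 d (\bigcup_(k < n) A k))); last first.
  by apply: le_H1 => x [k _ Ak]; exists k.
elim: n => [|n ih]; first by rewrite big_nil H1_ge0.
rewrite big_nat_recr//=; apply: (le_trans (leeD2r _ ih)).
apply: (le_trans (H1_sep (rho0 n) _)).
  by move=> x y [k /= kn Ak] An; exact: sepA kn Ak An.
apply: le_H1 => x [[k /= kn Ak]|An]; last by exists n => /=.
by exists k => //=; exact: ltnW.
Qed.

(* Carathéodory's criterion: [T] is exhausted up to [C] by the sets [far C n],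
   and the layers between consecutive ones are separated when their indices
   have the same parity, so that their measures are summable. *)
Lemma H1_measurable_closed (C : set X) : mclosed C -> H1_measurable d C.
Proof.
move=> cC T; apply/eqP; rewrite eq_le; apply/andP; split.
  by apply: H1_sub_le => x Tx; have [Cx|Cx] := pselect (C x); [left|right].
have [->|Tfin] := eqVneq (H1 d T) +oo%E; first by rewrite leey.
have {}Tfin : (H1 d T < +oo)%E by rewrite ltey.
pose D n := T `&` far C n.
pose A m := D m.+1 `\` D m.
pose S b n := A (n.*2 + b)%N.
have rings (b : nat) : (\sum_(0 <= n <oo) H1 d (S b n) < +oo)%E.
  apply: le_lt_trans Tfin.
  (* With [m = n.*2 + b], each point of [A m] is closer than [m.+1%:R^-1] to [C], while the earlier
     layers of the same parity stay at distance at least [m%:R^-1]. *)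
  pose rho n : R := (n.*2 + b).-1.+1%:R^-1 - (n.*2 + b).+1%:R^-1.
  apply: (@le_trans _ _ (H1 d (\bigcup_n S b n))); last first.
    by apply: le_H1 => x [n _ [[]]].
  (* At index [0] the formula gives [0]; no layer precedes that one, so any positive value will
     do. *)
  pose rho' n := if (n.*2 + b)%N is 0%N then 1 else rho n.
  apply: (@H1_sep_series _ rho').
    move=> n; rewrite /rho' /rho; case: (n.*2 + b)%N => [|m]//=.
    by rewrite subr_gt0 ltf_pV2 ?posrE ?ltr0n// ltr_nat.
  move=> n k x y kn [[Tx fx] _] [[Ty _] fy]; rewrite /rho' /rho.
  have := fy; have : (k.*2 + b < (n.*2 + b).-1)%N.
    rewrite -subn1 ltn_subRL addnC addn1.
    have : (k.+1.*2 <= n.*2)%N by rewrite leq_double.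
    by rewrite doubleS => h; rewrite -!addSn leq_add2r.
  case: (n.*2 + b)%N => [|m]//= km fyN.
  have /existsNP[z /not_implyP[Cz /negP]] : ~ far C m.+1 y by move=> ?; apply: fyN.
  rewrite -ltNge => yz.
  have xz : m.+1%:R^-1 <= d x z by apply: far_mono fx _ Cz.
  have := metric_tri hd y x z; move: xz yz.
  by move: (m.+1%:R^-1 : R) (m.+2%:R^-1 : R) => a b'; lra.
have tail b := nneseries_tail_cvg (rings b) (fun k _ => H1_ge0 d (S b k)).
apply/lee_addgt0Pr => e e0.
have e2 : (0 < (e / 2)%:E)%E by rewrite lte_fin; lra.
have [N0 h0] := cvge_ltP (tail 0%N) e2.
have [N1 h1] := cvge_ltP (tail 1%N) e2.
pose N := maxn N0 N1.
have {}h0 := h0 N (leq_maxl _ _); have {}h1 := h1 N (leq_maxr _ _).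
(* A point outside [C] lies in the layer [A n] for which [n.+1] is the first index with
   [far C n.+1]; if it is not in [far C N.*2], then [n] is at least [N.*2]. *)
have cover : T `&` ~` C `<=` D N.*2 `|`
    (\bigcup_k S 0%N (k + N)%N `|` \bigcup_k S 1%N (k + N)%N).
  move=> x [Tx Cx]; have [n0 fn0] := mclosedN cC Cx.
  have [xN|xN] := pselect (far C N.*2 x); [by left|right].
  have ex : exists n, `[< far C n x >] by exists n0; apply/asboolP.
  case: (ex_minnP ex) => -[|n] /asboolP fn minn.
    by exfalso; apply: xN; exact: far_mono fn.
  have An : A n x.
    split; first by [].
    move=> [_ ?]; have := minn n (asboolT _); rewrite ltnn => h.
    by have : false by apply: h.
  have Nn : (N.*2 <= n)%N.
    rewrite leqNgt; apply/negP => nN; apply: xN.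
    exact: far_mono fn.
  have Nh : (N <= n./2)%N by rewrite -(doubleK N) half_leq.
  move: (odd_double_half n); case: (odd n) => nE; [right|left];
    exists (n./2 - N)%N => //; rewrite /S subnK//.
  - by rewrite addnC nE.
  - by rewrite addn0; rewrite add0n in nE; rewrite nE.
have DN : (H1 d (T `&` C) + H1 d (D N.*2) <= H1 d T)%E.
  apply: (le_trans (H1_sep (natSinv_gt0 R N.*2) _)).
    by move=> x y [_ Cx] [_ fy]; rewrite metric_sym//; exact: fy.
  by apply: le_H1 => x [[]|[]].
have tailE b : (H1 d (\bigcup_k S b (k + N)%N) <=
    \sum_(N <= k <oo | xpredT k) H1 d (S b k))%E.
  apply: (le_trans (H1_bigcup_le _ _)).
  rewrite -(nneseries_addn (f := fun k => H1 d (S b k)))//.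
  by move=> i; exact: H1_ge0.
apply: (@le_trans _ _ (H1 d (T `&` C) + (H1 d (D N.*2) + e%:E))%E); last first.
  by rewrite addeA leeD2r.
rewrite leeD2l//; apply: (le_trans (H1_sub_le _ cover)).
rewrite leeD2l//; apply: (le_trans (H1U_le _ _ _)).
have -> : e%:E = ((e / 2)%:E + (e / 2)%:E)%E by rewrite -EFinD; congr EFin; lra.
by apply: leeD; [apply: le_trans (ltW h0)|apply: le_trans (ltW h1)]; exact: tailE.
Qed.

Lemma H1_measurable_null (A : set X) : H1 d A = 0%E -> H1_measurable d A.
Proof.
move=> A0 T; apply/eqP; rewrite eq_le; apply/andP; split.
  by apply: H1_sub_le => x Tx; have [Ax|Ax] := pselect (A x); [left|right].
rewrite (@H1_null_sub _ _ _ (T `&` A) A)// add0e.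
exact: le_H1.
Qed.

End ClosedSets.

(** * Regularity of the Hausdorff measure *)

Section HausdorffMeasure.
Variables (R : realType) (disp : measure_display) (X : measurableType disp).
Variables (d : X -> X -> R) (mu : {measure set X -> \bar R}).
Hypothesis hmeas : forall A : set X, measurable A <-> H1_measurable d A.
Hypothesis hmu : forall A : set X, measurable A -> mu A = H1 d A.
Hypothesis hd : is_metric d.

Lemma mclosed_measurable (C : set X) : mclosed d C -> measurable C.
Proof. by move=> cC; apply/hmeas; exact: H1_measurable_closed. Qed.

Lemma null_measurable (A : set X) : H1 d A = 0%E -> measurable A.
Proof. by move=> A0; apply/hmeas; exact: H1_measurable_null. Qed.

Lemma mball_measurable x r : measurable (mball d x r).
Proof.
rewrite -[mball d x r]setCK; apply: measurableC; apply: mclosed_measurable => y h.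
rewrite /mball /= => xy; have [|z /= xz yz] := h (r - d x y).
  by rewrite subr_gt0.
apply: xz; rewrite /mball /=.
by have := metric_tri hd y x z; lra.
Qed.

(** Continuity of [mu] from above, by which infinite exhaustions are cut off at a finite stage. *)
Lemma H1_nonincreasing_lt (G : nat -> set X) (kap : R) :
  (forall n, measurable (G n)) -> (forall m n, (m <= n)%N -> G n `<=` G m) ->
  (H1 d (G 0%N) < +oo)%E -> H1 d (\bigcap_n G n) = 0%E -> 0 < kap ->
  exists n, (H1 d (G n) < kap%:E)%E.
Proof.
move=> mG Gle G0 Gcap kap0.
have mcap : measurable (\bigcap_n G n) by exact: bigcapT_measurable.
have cvgG : mu (G n) @[n --> \oo] --> mu (\bigcap_n G n).
  apply: nonincreasing_cvg_mu => //; first by rewrite hmu.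
  by move=> m n mn; apply/subsetPset; exact: Gle.
have [|N h] := @cvge_ltP _ _ _ kap%:E cvgG; first by rewrite hmu// Gcap lte_fin.
by exists N; rewrite -hmu//; exact: h.
Qed.

Lemma H1_exhaust (E N : set X) (F : nat -> set X) (kap : R) :
  measurable E -> (H1 d E < +oo)%E -> H1 d N = 0%E ->
  (forall n, measurable (F n)) -> E `<=` N `|` \bigcup_n F n -> 0 < kap ->
  exists n, (H1 d (E `\` \bigcup_(i < n) F i) < kap%:E)%E.
Proof.
move=> mE Efin N0 mF EF kap0.
apply: H1_nonincreasing_lt => //.
- move=> n; apply: measurableD => //.
  by apply: bigcup_measurable => i _.
- move=> m n mn x [Ex h]; split => // -[i /= im Fi]; apply: h.
  by exists i => //=; exact: leq_trans mn.
- by apply: le_lt_trans Efin; apply: le_H1 => x [].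
apply: (@H1_null_sub _ _ _ _ N) => // x h; have [Ex _] := h 0%N I.
have [//|[n _ Fn]] := EF _ Ex.
by have [_ []] := h n.+1 I; exists n => /=.
Qed.

Lemma H1_measurableID (E A : set X) : measurable A ->
  (H1 d E = H1 d (E `&` A) + H1 d (E `\` A))%E.
Proof. by move=> /hmeas; apply. Qed.

(** A point is kept in the first [C i] that contains it, and has positive distance to the closed
    sets before. Requiring this distance to be at least [m.+1%:R^-1] gives uniformly separated
    closed pieces, and the loss vanishes as [m] grows. *)
Lemma separated_exhaust (E : set X) (C : nat -> set X) (n : nat) (kap : R) :
  measurable E -> (H1 d E < +oo)%E -> (forall i, mclosed d (C i)) -> 0 < kap ->
  exists (T : nat -> set X) (rho : R), 0 < rho /\
    [/\ forall i, mclosed d (T i), forall i, T i `<=` C i,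
        forall i j x y, i <> j -> T i x -> T j y -> rho <= d x y &
        (H1 d ((E `&` \bigcup_(i < n) C i) `\` \bigcup_(i < n) T i) < kap%:E)%E].
Proof.
move=> mE Efin cC kap0.
pose T m i := C i `&` \bigcap_(j < i) far d (C j) m.
have cT m i : mclosed d (T m i).
  apply: mclosedI => // x h j ji; apply: (far_closed hd) => e /h[y fy ?].
  by exists y => //; exact: fy.
have Tle m p i : (m <= p)%N -> T m i `<=` T p i.
  by move=> mp x [Cx fx]; split => // j /fx; exact: far_mono.
have mU (S : nat -> set X) : (forall i, mclosed d (S i)) -> measurable (\bigcup_(i < n) S i).
  by move=> cS; apply: bigcup_measurable => i _; exact: mclosed_measurable.
have [m hm] : exists m, (H1 d ((E `&` \bigcup_(i < n) C i) `\`
    \bigcup_(i < n) T m i) < kap%:E)%E.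
  apply: (@H1_nonincreasing_lt (fun m => (E `&` \bigcup_(i < n) C i) `\`
    \bigcup_(i < n) T m i)) => //.
  - move=> m; apply: measurableD; last exact: mU.
    by apply: measurableI => //; exact: mU.
  - move=> m p mp x [ECx h]; split => // -[i /= ni Ti]; apply: h.
    by exists i => //; exact: Tle Ti.
  - by apply: le_lt_trans Efin; apply: le_H1 => x [[]].
  - rewrite (_ : \bigcap_m _ = set0) ?H1_set0// -subset0 => x h.
    have [[_ [i0 /= i0n Ci0]] _] := h 0%N I.
    have ex : exists i, `[< C i x >] by exists i0; apply/asboolP.
    case: (ex_minnP ex) => i /asboolP Ci mini.
    have ni : (i < n)%N by apply: leq_ltn_trans i0n; apply: mini; apply/asboolP.
    have nC j : (j < i)%N -> ~ C j x.
      by move=> ji Cj; have := mini j (asboolT Cj); rewrite leqNgt ji.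
    have [m fm] : exists m, forall j, (j < i)%N -> far d (C j) m x.
      elim: i {ex Ci mini ni} nC => [|i ih] nC; first by exists 0%N.
      have [m fm] := ih (fun j ji => nC j (ltnW ji)).
      have [m' fm'] := mclosedN (cC i) (nC i (ltnSn i)).
      exists (maxn m m') => j; rewrite ltnS leq_eqVlt => /predU1P[->|ji].
        by apply: far_mono fm'; exact: leq_maxr.
      by apply: far_mono (fm _ ji); exact: leq_maxl.
    by have [_ []] := h m I; exists i => //; split.
exists (T m), m.+1%:R^-1; split; first exact: natSinv_gt0.
split => //; first by move=> i x [].
move=> i j x y /eqP; rewrite neq_lt => /orP[ij|ji] [Cx fx] [Cy fy].
  by rewrite metric_sym//; exact: fy ij _ Cx.
exact: fx ji _ Cy.
Qed.

Definition thick (S : set X) (eta : R) : set X :=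
  [set y | exists2 x, S x & d x y < eta].

Lemma thick_closedC S eta : mclosed d (~` thick S eta).
Proof.
move=> y h [x Sx xy]; have [|z Nz yz] := h (eta - d x y); first by rewrite subr_gt0.
by apply: Nz; exists x => //; have := metric_tri hd y x z; lra.
Qed.

Lemma diam_thick S eta : 0 < eta ->
  (diam d (thick S eta) <= diam d S + (eta *+ 2)%:E)%E.
Proof.
move=> eta0; apply: diam_le.
  by rewrite adde_ge0 ?diam_ge0// lee_fin mulrn_wge0// ltW.
move=> x y [x' Sx xx'] [y' Sy yy'].
apply: (@le_trans _ _ ((d x' y')%:E + (eta *+ 2)%:E)%E); last first.
  by rewrite leeD2r// le_diam.
rewrite -EFinD lee_fin mulr2n.
have := metric_tri hd x' x y; have := metric_tri hd y' x' y.
by rewrite (metric_sym hd x x'); lra.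
Qed.

(** Thickening the members of nearly optimal covers makes them open at a summable cost in diameter.
    Each thickened cover also covers the intersection of the [U n], and its mesh at most doubles.
    Openness is expressed by closed complements. *)
Lemma open_hull (A : set X) : (H1 d A < +oo)%E ->
  exists U : nat -> set X, [/\ forall n, mclosed d (~` U n),
    forall n, A `<=` U n & (H1 d (\bigcap_n U n) <= H1 d A)%E].
Proof.
move=> Afin; pose r n : R := n.+1%:R^-1.
have r0 n : 0 < r n by exact: natSinv_gt0.
have /choice[C hC] : forall n, exists C : nat -> set X,
  [/\ A `<=` \bigcup_i C i, (forall i, (diam d (C i) <= (r n)%:E)%E) &
    (\sum_(0 <= i <oo) diam d (C i) <= H1 d A + (r n)%:E)%E].
  by move=> n; exact: H1_cover.
(* Thickening by [eta n i] adds at most twice that to the diameter, hence at most [r n] in total. *)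
pose eta n i : R := r n / (2 ^ i.+1)%:R / 2.
have eta0 n i : 0 < eta n i by rewrite /eta !divr_gt0 ?r0// ltr0n expn_gt0.
have eta2 n i : eta n i *+ 2 = r n / (2 ^ i.+1)%:R by rewrite /eta mulr2n; lra.
pose U n := \bigcup_i thick (C n i) (eta n i).
exists U; split.
- move=> n x h [i _ Ui]; have := @thick_closedC (C n i) (eta n i) x.
  apply => // e /h[y Ny xy]; exists y => // Ty; apply: Ny.
  by exists i.
- move=> n x Ax; have [+ _ _] := hC n; move=> /(_ _ Ax)[i _ Ci].
  by exists i => //; exists x => //; rewrite metric_refl.
- apply/lee_addgt0Pr => e e0; apply: H1_le => de de0.
  have [|n] := @ex_natSinv_lt _ (Num.min de e / 2).
    by rewrite divr_gt0// lt_min de0.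
  rewrite -/(r n) => rn; have [rnde rne] : r n * 2 <= de /\ r n * 2 <= e.
    have : Num.min de e <= de by rewrite ge_min lexx.
    have : Num.min de e <= e by rewrite ge_min lexx orbT.
    by lra.
  have [AC Cd Cs] := hC n.
  apply: (@le_trans _ _ (\sum_(0 <= i <oo) diam d (thick (C n i) (eta n i)))%E).
    apply: H1delta_le_cover; first by move=> x /(_ n I).
    move=> i; apply: (le_trans (diam_thick _ (eta0 n i))).
    apply: (@le_trans _ _ ((r n)%:E + (r n)%:E)%E); last first.
      by rewrite -EFinD lee_fin; lra.
    apply: leeD => //; rewrite lee_fin eta2 ler_pdivrMr ?ltr0n ?expn_gt0//.
    by rewrite ler_peMr ?(ltW (r0 n))// ler1n expn_gt0.
  apply: (@le_trans _ _ (\sum_(0 <= i <oo) (diam d (C n i) +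
      (r n / (2 ^ i.+1)%:R)%:E))%E).
    apply: lee_nneseries => [i _ _|i _]; first exact: diam_ge0.
    by rewrite -eta2; exact: diam_thick.
  apply: (le_trans (epsilon_trick xpredT _ (ltW (r0 n)))).
    by move=> i; exact: diam_ge0.
  apply: (le_trans (leeD2r _ Cs)); rewrite -addeA leeD2l// -EFinD lee_fin.
  by lra.
Qed.

Lemma opensetC_measurable (U : set X) : mclosed d (~` U) -> measurable U.
Proof.
by move=> cU; rewrite -[U]setCK; apply: measurableC; exact: mclosed_measurable.
Qed.

(** The hull [B] of [E] is approximated from inside by a closed [C], cut out by points far from the
    complement of each [U k]. As [B] exceeds [E] by a null set, finitely many open sets of a hull of
    the excess meet [B] in small measure, and their intersection is removed from [C]. *)
Lemma inner_regular (E : set X) (kap : R) : measurable E ->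
  (H1 d E < +oo)%E -> 0 < kap ->
  exists K, [/\ mclosed d K, K `<=` E & (H1 d (E `\` K) < kap%:E)%E].
Proof.
move=> mE Efin kap0.
have [U [cU EU UE]] := open_hull Efin.
have mU n : measurable (U n) by exact: opensetC_measurable.
pose B := \bigcap_n U n.
have mB : measurable B by exact: bigcapT_measurable.
have Bfin : (H1 d B < +oo)%E := le_lt_trans UE Efin.
have EB : E `<=` B by move=> x Ex n _; exact: EU.
have BE0 : H1 d (B `\` E) = 0%E.
  have := H1_measurableID B mE; rewrite setIidr//.
  have Ef : H1 d E \is a fin_num by rewrite ge0_fin_numE// H1_ge0.
  move=> BEq; apply/eqP; rewrite eq_le H1_ge0 andbT.
  by rewrite -(leeD2lE _ _ Ef) adde0 -BEq.
have [|V [cV BEV VBE]] := @open_hull (B `\` E); first by rewrite BE0 ltry.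
have mV n : measurable (V n) by exact: opensetC_measurable.
have kap4 : 0 < kap / 4 by lra.
pose W n := B `&` \bigcap_(i < n.+1) V i.
have [n Wn] : exists n, (H1 d (W n) < (kap / 4)%:E)%E.
  apply: H1_nonincreasing_lt => //.
  - move=> n; apply: measurableI => //; exact: bigcap_measurableType.
  - by move=> m n mn x [Bx h]; split => // i /= im; apply: h => /=; exact: leq_trans mn.
  - by apply: le_lt_trans Bfin; apply: le_H1 => x [].
  - apply/eqP; rewrite eq_le H1_ge0 andbT -BE0; apply: le_trans VBE.
    by apply: le_H1 => x h i _; have [_] := h i I; apply => /=.
have /choice[m hm] : forall k, exists m,
    (H1 d (B `\` far d (~` U k) m) < (kap / 4 / (2 ^ k.+1)%:R)%:E)%E.
  move=> k; apply: (@H1_nonincreasing_lt (fun m => B `\` far d (~` U k) m)).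
  - move=> m; apply: measurableD => //; apply: mclosed_measurable.
    exact: far_closed.
  - by move=> m p mp x [Bx h]; split => // fm; apply: h; exact: far_mono fm.
  - by apply: le_lt_trans Bfin; apply: le_H1 => x [].
  - rewrite (_ : \bigcap_i _ = set0) ?H1_set0// -subset0 => x h.
    have [Bx _] := h 0%N I; have [|m fm] := mclosedN (cU k) (x := x).
      by apply; exact: Bx.
    by have [_] := h m I.
  - by rewrite divr_gt0// ltr0n expn_gt0.
pose C := \bigcap_k far d (~` U k) (m k).
have cC : mclosed d C by apply: mclosed_bigcap => k; exact: far_closed.
have CB : C `<=` B.
  by move=> x h k _; apply: contrapT; have := farN hd (h k I); exact.
have BC : (H1 d (B `\` C) <= (kap / 4)%:E)%E.
  apply: (@le_trans _ _ (\sum_(0 <= k <oo) H1 d (B `\` far d (~` U k) (m k)))%E).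
    apply: H1_sub_bigcup_le => x [Bx] /existsNP[k /not_implyP[_ h]].
    by exists k.
  apply: nneseries_le_half; first exact: kap4.
    by move=> k; exact: H1_ge0.
  by move=> k; apply: ltW; exact: hm.
exists (C `&` ~` \bigcap_(i < n.+1) V i); split.
- apply: mclosedI => // x h hx.
  (* A finite intersection of open sets: one radius serves for all of them. *)
  have [N hN] : exists N, forall i, (i < n.+1)%N -> far d (~` V i) N x.
    elim: n.+1 hx {h Wn} => [|i ih] hx; first by exists 0%N.
    have [|N fN] := ih; first by move=> j /= ji; apply: hx => /=; exact: ltnW.
    have [|N' fN'] := mclosedN (cV i) (x := x); first by apply; apply: hx => /=.
    exists (maxn N N') => j; rewrite ltnS leq_eqVlt => /predU1P[->|ji].
      by apply: far_mono fN'; exact: leq_maxr.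
    by apply: far_mono (fN _ ji); exact: leq_maxl.
  have [y yV xy] := h _ (natSinv_gt0 R N).
  apply: yV => i /= ni; apply: contrapT => Viy.
  by have := hN i ni y Viy; rewrite leNgt xy.
- move=> x [Cx NV]; apply: contrapT => NE; apply: NV => i _.
  by apply: BEV; split => //; exact: CB.
- apply: (@le_lt_trans _ _ (H1 d (B `\` C) + H1 d (W n))%E).
    apply: H1_sub_le => x [Ex h]; have [Cx|] := pselect (C x).
      right; split; first exact: EB.
      by apply: contrapT => ?; apply: h.
    by left; split => //; exact: EB.
  apply: (@le_lt_trans _ _ ((kap / 4)%:E + (kap / 4)%:E)%E).
    by apply: leeD => //; exact: ltW.
  by rewrite -EFinD lte_fin; lra.
Qed.

End HausdorffMeasure.

(** * Vitali coverings on the real line *)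

Section RealLine.
Variable R : realType.

(** Consecutive intervals of length [h] cover; the last one overshoots [b] by at most [h <= e]. *)
Lemma H1_interval (M : set R) (a b : R) : a <= b ->
  (forall x, M x -> a <= x <= b) -> (H1 (@dR R) M <= (b - a)%:E)%E.
Proof.
move=> ab Mab; apply/lee_addgt0Pr => e e0; apply: H1_le => de de0.
pose h := Num.min de e.
have h0 : 0 < h by rewrite lt_min de0.
pose N := (Num.trunc ((b - a) / h)).+1.
pose C i := if (i < N)%N then [set x : R | a + h * i%:R <= x <= a + h * i.+1%:R]
            else set0.
have Ch i : (diam (@dR R) (C i) <= h%:E)%E.
  apply: diam_le; first by rewrite lee_fin ltW.
  move=> x y; rewrite /C; case: ifP => // _ /= /andP[x1 x2] /andP[y1 y2].
  rewrite /dR lee_fin ler_norml.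
  have : h * i.+1%:R = h * i%:R + h by rewrite -addn1 natrD mulrDr mulr1.
  by move=> hi; apply/andP; split; lra.
apply: (@le_trans _ _ (\sum_(0 <= i <oo) diam (@dR R) (C i))%E).
  apply: H1delta_le_cover; last first.
    by move=> i; apply: (le_trans (Ch i)); rewrite lee_fin ge_min lexx.
  move=> x /Mab /andP[ax xb].
  have xa0 : 0 <= (x - a) / h by rewrite divr_ge0 ?subr_ge0// ltW.
  have /andP[t1 t2] := trunc_itv xa0.
  exists (Num.trunc ((x - a) / h)) => //; rewrite /C ifT; last first.
    rewrite ltnS; apply: le_truncn; rewrite ler_pM2r ?invr_gt0//.
    by rewrite lerD2r.
  rewrite ler_pdivlMr// in t1; rewrite ltr_pdivrMr// in t2.
  by rewrite /= (mulrC h) (mulrC h); apply/andP; split; lra.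
rewrite (nneseries_split 0 N); last by move=> *; exact: diam_ge0.
rewrite add0n [X in (_ + X)%E]eseries0 ?adde0; last first.
  move=> i Ni _; rewrite /C ltnNge Ni /=; apply/eqP.
  by rewrite eq_le diam_ge0 andbT; exact: diam_le.
apply: (@le_trans _ _ (\sum_(0 <= i < N) h%:E)%E); first exact: lee_sum.
rewrite sumEFin lee_fin sumr_const_nat subn0 -mulr_natr /N -natr1 mulrDr mulr1.
have he : h <= e by rewrite ge_min lexx orbT.
apply: lerD => //; rewrite mulrC -ler_pdivlMr//.
have : 0 <= (b - a) / h by rewrite divr_ge0 ?subr_ge0// ltW.
by move=> /trunc_itv/andP[].
Qed.

Lemma H1_image_interval (T X : Type) (d : X -> X -> R) (P : set T)
    (gam : T -> X) (tau : T -> R) (L a b : R) : 0 < L -> a <= b ->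
  (forall s t, P s -> P t -> d (gam s) (gam t) <= L * `|tau s - tau t|) ->
  (forall s, P s -> a <= tau s <= b) ->
  (H1 d (gam @` P) <= (L * (b - a))%:E)%E.
Proof.
move=> L0 ab lip Pab; apply: (le_trans (H1_lip_image (dY := @dR R) L0 lip)).
rewrite EFinM lee_wpmul2l ?lee_fin ?(ltW L0)//.
by apply: H1_interval => // _ [s Ps <-]; exact: Pab.
Qed.

Lemma closure_ball (c r : R) : 0 < r ->
  closure (ball c r) = [set x | `|c - x| <= r].
Proof.
move=> r0; rewrite is_ball_closure ?is_ball_ball// radius_ball_num ?ltW//.
by rewrite cpoint_ball// closed_ballE.
Qed.

(** The Vitali covering lemma for intervals given by centre and radius, with the countable disjoint
    subfamily renumbered by a set [J] of integers. *)
Lemma vitali_sequence (V : set (R * R)) (r : R) :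
  (forall p, V p -> 0 < p.2 <= r) ->
  exists (J : set nat) (c rho : nat -> R),
    [/\ forall n, J n -> V (c n, rho n),
        forall m n x, J m -> J n -> `|x - c m| < rho m -> `|x - c n| < rho n ->
          m = n &
        forall p x, V p -> `|x - p.1| <= p.2 ->
          exists2 n, J n & `|x - c n| <= 5 * rho n].
Proof.
(* A default radius makes every pair, also outside [V], a genuine ball. *)
move=> Vr; pose rad (p : R * R) := if 0 < p.2 then p.2 else 1.
have rad0 p : 0 < rad p by rewrite /rad; case: ifP.
pose B (p : R * R) : set R := ball p.1 (rad p).
have radE p : (radius (B p))%:num = rad p by rewrite radius_ball_num// ltW.
have VE p : V p -> rad p = p.2 by move=> /Vr/andP[p0 _]; rewrite /rad p0.
have [||| D [/countable_injP[f finj] DV tD cov]] :=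
  @vitali_lemma_infinite R (R * R)%type B V r.
- by move=> p; exact: is_ball_ball.
- by move=> p; rewrite radE.
- by move=> p Vp; rewrite radE VE//; have /andP[] := Vr _ Vp.
pose J := [set n | exists2 q, D q & f q = n].
pose q n := xget (0, 0) [set q | D q /\ f q = n].
have qP n : J n -> D (q n) /\ f (q n) = n.
  by move=> [p Dp fp]; apply: (@xgetPex _ _ [set q | D q /\ f q = n]); exists p.
exists J, (fun n => (q n).1), (fun n => (q n).2); split.
- by move=> n /qP[Dq _]; rewrite -surjective_pairing; exact: DV.
- move=> m n x /qP[Dm fm] /qP[Dn fn] xm xn; rewrite -fm -fn; congr f.
  apply: (tD _ _ Dm Dn); exists x; split; apply: subset_closure;
    rewrite /B /ball /= distrC VE.
  - exact: xm.
  - exact: DV.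
  - exact: xn.
  - exact: DV.
- move=> p x Vp xp; have [j [Dj _ _ sub]] := cov p Vp.
  exists (f j); first by exists j.
  have qj : q (f j) = j.
    have [Dq fq] : D (q (f j)) /\ f (q (f j)) = f j by apply: qP; exists j.
    by apply: finj => //; rewrite inE.
  rewrite /= qj distrC; have := sub x; rewrite /B scale_ballE// closure_ball//.
  rewrite closure_ball ?mulr_gt0// (VE _ Vp) (VE _ (DV _ Dj)) /=.
  by apply; rewrite distrC.
Qed.

(* The difference [tau - phi] is nondecreasing along [tau] with oscillation at
   most [e]; a point is discarded when some difference quotient of it exceeds
   [lam], and the weak-type bound is the usual Vitali covering argument. *)
Lemma H1_nonexpanding_part (T X : Type) (d : X -> X -> R) (P : set T)
    (gam : T -> X) (tau phi : T -> R) (e lam : R) : 0 < lam ->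
  0 <= e ->
  (forall s t, P s -> P t -> d (gam s) (gam t) <= `|tau s - tau t|) ->
  (forall s t, P s -> P t -> `|phi s - phi t| <= `|tau s - tau t|) ->
  (forall s t, P s -> P t -> tau s <= tau t ->
    (tau t - tau s) - (phi t - phi s) <= e) ->
  (H1 d (gam @` [set t | P t /\ exists2 s, P s &
     (`|phi s - phi t| < (1 - lam) * `|tau s - tau t|)%R]) <=
   (10 * e / lam)%:E)%E.
Proof.
move=> lam0 e0 gamlip philip osc; set Bad := [set t | _].
have e10 : 0 <= 10 * e / lam by rewrite divr_ge0 ?(ltW lam0)// mulr_ge0.
have [[t0 Pt0]|noP] := pselect (exists t, P t); last first.
  have -> : Bad = set0.
    by rewrite -subset0 => t [Pt _]; apply: noP; exists t.
  by rewrite image_set0 H1_set0 lee_fin.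
pose psi t := tau t - phi t.
have psi_mono s t : P s -> P t -> tau s <= tau t -> psi s <= psi t.
  move=> Ps Pt st; have := philip _ _ Pt Ps.
  by rewrite [leRHS]ger0_norm ?subr_ge0// ler_norml /psi => /andP[_]; lra.
have psi_osc s t : P s -> P t -> psi t - psi s <= e.
  move=> Ps Pt; have [st|/ltW ts] := leP (tau s) (tau t).
    by have := osc _ _ Ps Pt st; rewrite /psi; lra.
  by have := psi_mono _ _ Pt Ps ts; lra.
pose Q (p : R * R) (ab : T * T) := [/\ P ab.1, P ab.2,
  lam * (tau ab.2 - tau ab.1) < psi ab.2 - psi ab.1,
  p.1 - p.2 = tau ab.1 & p.1 + p.2 = tau ab.2].
(* Intervals with endpoints in the image of [tau] over which [psi] grows by more than [lam] times
   their length; each bad point gives an endpoint of one. *)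
pose V := [set p | 0 < p.2 /\ exists ab, Q p ab].
have Vr p : V p -> 0 < p.2 <= e / lam.
  move=> [p0 [[a b] [/= Pa Pb ab pa pb]]]; rewrite p0 /= ler_pdivlMr//.
  have := psi_osc _ _ Pa Pb; rewrite -pa -pb in ab.
  have := mulr_gt0 lam0 p0; lra.
have BadV t : Bad t -> exists2 p, V p & `|tau t - p.1| <= p.2.
  move=> [Pt [s Ps st]].
  have main a b : P a -> P b -> tau a < tau b ->
      lam * (tau b - tau a) < psi b - psi a -> tau t = tau a \/ tau t = tau b ->
      exists2 p, V p & `|tau t - p.1| <= p.2.
    move=> Pa Pb ab pab tab; exists ((tau a + tau b) / 2, (tau b - tau a) / 2).
      split; first by rewrite /= divr_gt0// subr_gt0.
      by exists (a, b); split => //=; lra.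
    by rewrite /= ler_norml; apply/andP; case: tab => ->; split; lra.
  have [ts|ts|ts] := ltgtP (tau t) (tau s).
  - apply: (main t s) => //; last by left.
    move: st; rewrite [X in _ * X]ger0_norm ?subr_ge0 ?(ltW ts)//.
    by rewrite ltr_norml /psi => /andP[_]; lra.
  - apply: (main s t) => //; last by right.
    move: st; rewrite distrC [X in _ * X]distrC.
    rewrite [X in _ * X]ger0_norm ?subr_ge0 ?(ltW ts)//.
    by rewrite ltr_norml /psi => /andP[_]; lra.
  - by move: st; rewrite ts subrr normr0 mulr0 ltNge normr_ge0.
have [J [c [rho [JV Jdisj Jcov]]]] := vitali_sequence Vr.
have /choice[ab hab] : forall n, exists ab, J n -> Q (c n, rho n) ab.
  move=> n; have [Jn|NJ] := pselect (J n); last by exists (t0, t0).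
  by have [_ [ab Qab]] := JV _ Jn; exists ab.
(* As [psi] is monotone along [tau], these intervals of values are disjoint, and each is longer than
   [lam] times its source. All lie within [e] of [psi t0], so their lengths add up to at most
   [2 * e]; the factor [5] of the covering makes it [10]. *)
pose N n : set R := if `[< J n >] then `]psi (ab n).1, psi (ab n).2[%classic else set0.
have mN n : measurable (N n) by rewrite /N; case: ifP.
have order m n x : J m -> J n -> N m x -> N n x ->
    tau (ab m).2 <= tau (ab n).1 -> False.
  move=> Jm Jn; have [_ Pm _ _ _] := hab _ Jm; have [Pn _ _ _ _] := hab _ Jn.
  rewrite /N !asboolT//= !in_itv/= => /andP[_ xm] /andP[xn _] mn.
  by have := psi_mono _ _ Pm Pn mn; lra.
have tN : trivIset setT N.
  move=> m n _ _ [x [Nm Nn]].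
  have [Jm|NJ] := pselect (J m); last by move: Nm; rewrite /N asboolF.
  have [Jn|NJ] := pselect (J n); last by move: Nn; rewrite /N asboolF.
  have [_ _ _ am bm] := hab _ Jm; have [_ _ _ an bn] := hab _ Jn.
  have [/(order _ _ _ Jm Jn Nm Nn)//|mn] := leP (tau (ab m).2) (tau (ab n).1).
  have [/(order _ _ _ Jn Jm Nn Nm)//|nm] := leP (tau (ab n).2) (tau (ab m).1).
  have [rm0 _] := JV _ Jm; have [rn0 _] := JV _ Jn; rewrite /= in am bm an bn rm0 rn0.
  pose lo := Num.max (tau (ab m).1) (tau (ab n).1).
  pose hi := Num.min (tau (ab m).2) (tau (ab n).2).
  have lohi : lo < hi.
    by rewrite /lo /hi lt_min !gt_max; apply/andP; split; apply/andP; split => //; lra.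
  have : tau (ab m).1 <= lo by rewrite le_max lexx.
  have : tau (ab n).1 <= lo by rewrite le_max lexx orbT.
  have : hi <= tau (ab m).2 by rewrite ge_min lexx.
  have : hi <= tau (ab n).2 by rewrite ge_min lexx orbT.
  move=> h1 h2 h3 h4; apply: (@Jdisj m n ((lo + hi) / 2)) => //;
    by rewrite ltr_norml; apply/andP; split; lra.
pose S n := [set t | [/\ J n, P t & `|tau t - c n| <= 5 * rho n]].
have cover : gam @` Bad `<=` \bigcup_n (gam @` S n).
  move=> _ [t Bt <-]; have [p Vp tp] := BadV _ Bt.
  by have [n Jn tn] := Jcov _ _ Vp tp; exists n => //; exists t => //; case: Bt.
have Sn n : (H1 d (gam @` S n) <= (5 / lam)%:E * lebesgue_measure (N n))%E.
  have [Jn|NJ] := pselect (J n); last first.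
    have -> : S n = set0 by rewrite -subset0 => t [].
    by rewrite image_set0 H1_set0 mule_ge0// lee_fin divr_ge0// ltW.
  have [Pa Pb pab an bn] := hab _ Jn; have [rn0 _] := JV _ Jn; rewrite /= in an bn rn0.
  rewrite /N asboolT// lebesgue_measure_itv/= lte_fin.
  have lt2 : lam * (2 * rho n) < psi (ab n).2 - psi (ab n).1.
    by move: pab; rewrite -an -bn; lra.
  have pos : 0 < lam * (2 * rho n) by rewrite !mulr_gt0.
  rewrite ifT -?EFinB -?EFinM; last by rewrite -subr_gt0; lra.
  apply: (@le_trans _ _ (1 * ((c n + 5 * rho n) - (c n - 5 * rho n)))%:E).
    apply: (@H1_image_interval _ _ _ _ _ tau) => //; first lra.
      by move=> s t [_ Ps _] [_ Pt _]; rewrite mul1r gamlip.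
    by move=> s [_ _]; rewrite ler_norml => /andP[]; lra.
  rewrite lee_fin mul1r mulrAC ler_pdivlMr//.
  lra.
apply: (le_trans (H1_sub_bigcup_le d cover)).
apply: (@le_trans _ _ (\sum_(0 <= n <oo) ((5 / lam)%:E * lebesgue_measure (N n)))%E).
  by apply: lee_nneseries => // n _ _; exact: H1_ge0.
rewrite nneseriesZl//.
have sumN := series_measure_bigcup (@lebesgue_measure R) mN tN.
have NI : (lebesgue_measure (\bigcup_n N n) <= (2 * e)%:E)%E.
  apply: (@le_trans _ _ (lebesgue_measure `[psi t0 - e, psi t0 + e]%classic)).
    apply: le_measure; rewrite ?inE//; first exact: bigcupT_measurable.
    move=> x [n _]; have [Jn|NJ] := pselect (J n); last by rewrite /N asboolF.
    rewrite /N asboolT//=.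
    have [Pa Pb _ _ _] := hab _ Jn; rewrite !in_itv /= => /andP[xa xb].
    have := psi_osc _ _ Pa Pt0; have := psi_osc _ _ Pt0 Pb.
    by move=> h1 h2; apply/andP; split; lra.
  rewrite lebesgue_measure_itv/= lte_fin; case: ifP => _; last by rewrite lee_fin; lra.
  by rewrite -EFinB lee_fin; lra.
apply: (@le_trans _ _ ((5 / lam)%:E * (2 * e)%:E)%E).
  by rewrite lee_wpmul2l ?lee_fin ?divr_ge0 ?(ltW lam0)// sumN.
rewrite -EFinM lee_fin.
by rewrite mulrAC ler_pM2r ?invr_gt0//; lra.
Qed.

End RealLine.

(** * Arc length and almost isometric pieces of a curve *)

Section ArcDecomposition.
Variables (R : realType) (X : Type) (d : X -> X -> R).
Hypothesis hd : is_metric d.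

(** [h i] is a coordinate on [S i] with range of length [len i]; the sum of the [len i] controls the
    number of points in a net of given mesh. *)
Definition almost_isometric_family (eta : R) (n : nat) (S : nat -> set X)
    (h : nat -> X -> R) (len : nat -> R) : Prop :=
  [/\ forall i x y, `|h i x - h i y| <= d x y,
      forall i x y, S i x -> S i y -> (1 - eta) * d x y <= `|h i x - h i y|,
      forall i, (i < n)%N -> 0 <= len i &
      forall i x, (i < n)%N -> S i x -> 0 <= h i x <= len i].

Section Arc.
Variables (T : Type) (P : set T) (gam : T -> X) (sig : T -> R) (L l r : R).
Hypothesis L0 : 0 < L.
Hypothesis Plr : forall t, P t -> l <= sig t <= r.
Hypothesis gamlip : forall s t, P s -> P t ->
  d (gam s) (gam t) <= L * `|sig s - sig t|.

(** Vertices of an inscribed polygon, by decreasing parameter from [t]. The parameter set [T] is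
    abstract: it is the line for a Lipschitz curve, and [X] itself for a set with a coordinate
    function [sig]. *)
Fixpoint chain (t : T) (w : seq T) : Prop :=
  if w is s :: w' then [/\ P t, sig s <= sig t & chain s w'] else P t.

Fixpoint chain_length (t : T) (w : seq T) : R :=
  if w is s :: w' then d (gam t) (gam s) + chain_length s w' else 0.

(** The variation of [gam] over the points of [P] with parameter at most [sig t]; gaps of [P] are
    crossed by chords. *)
Definition arc_length (t : T) : R :=
  sup [set c | exists2 w, chain t w & c = chain_length t w].

Lemma chain_head t w : chain t w -> P t.
Proof. by case: w => [|s w]//= []. Qed.

Lemma chain_length_le t w : chain t w -> chain_length t w <= L * (sig t - l).
Proof.
elim: w t => [|s w ih] t /=.
  by move=> /Plr/andP[lt _]; rewrite mulr_ge0 ?subr_ge0// ltW.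
move=> [Pt st sw]; have Ps := chain_head sw.
have := gamlip Pt Ps; rewrite ger0_norm ?subr_ge0// => h.
by have := ih _ sw; lra.
Qed.

Let has_sup_length t : P t ->
  has_sup [set c | exists2 w, chain t w & c = chain_length t w].
Proof.
move=> Pt; split; first by exists 0, [::].
by exists (L * (sig t - l)) => _ [w tw ->]; exact: chain_length_le.
Qed.

Lemma le_arc_length t w : chain t w -> chain_length t w <= arc_length t.
Proof.
move=> tw; apply: ub_le_sup; last by exists w.
by have [_] := has_sup_length (chain_head tw).
Qed.

Lemma arc_length_le t : P t -> arc_length t <= L * (sig t - l).
Proof.
move=> Pt; apply: ge_sup; first by have [] := has_sup_length Pt.
by move=> _ [w tw ->]; exact: chain_length_le.
Qed.

Lemma arc_length_ge0 t : P t -> 0 <= arc_length t.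
Proof. by move=> Pt; apply: (@le_arc_length t [::]). Qed.

Lemma arc_length_add s t : P s -> P t -> sig s <= sig t ->
  arc_length s + d (gam t) (gam s) <= arc_length t.
Proof.
move=> Ps Pt st; rewrite -lerBrDr; apply: ge_sup.
  by have [] := has_sup_length Ps.
move=> _ [w sw ->]; rewrite lerBrDr addrC.
exact: (@le_arc_length t (s :: w)).
Qed.

(** With this, [arc_length] can serve as [tau] in [H1_nonexpanding_part]. *)
Lemma dist_le_arc_length s t : P s -> P t ->
  d (gam s) (gam t) <= `|arc_length s - arc_length t|.
Proof.
move=> Ps Pt; have [st|/ltW st] := leP (sig s) (sig t).
  have h := arc_length_add Ps Pt st; have := metric_ge0 hd (gam t) (gam s).
  rewrite (metric_sym hd (gam s)) distrC => d0.
  by rewrite ger0_norm; lra.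
have h := arc_length_add Pt Ps st; have := metric_ge0 hd (gam s) (gam t).
by move=> d0; rewrite ger0_norm; lra.
Qed.

(** Between consecutive vertices the distance to the lower one falls short of the arc length by at
    most the excess [e] of arc over chord. [H1_nonexpanding_part] discards measure [10 * e / eta]
    there, and the excesses telescope to the deficit of the whole polygon. *)
Lemma chain_decomposition (eta : R) x w : 0 < eta < 1 -> chain x w ->
  let z := last x w in
  exists n S h len, [/\ almost_isometric_family eta n S h len,
    \sum_(i < n) len i <= arc_length x - arc_length z &
    (H1 d (gam @` [set t | P t /\ (sig z <= sig t <= sig x)%R] `\`
      \bigcup_(i < n) S i) <=
     (10 * (arc_length x - arc_length z - chain_length x w) / eta)%:E)%E].
Proof.
move=> /andP[eta0 eta1]; elim: w x => [|y w ih] x /=.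
  move=> Px; exists 0%N, (fun=> set0), (fun=> fun=> 0), (fun=> 0); split.
  - by split => // i u v; rewrite subrr normr0 metric_ge0.
  - by rewrite big_ord0 subrr.
  - rewrite !subrr mulr0 mul0r.
    (* Without edges, only points with the parameter of [x] remain, and all have the image
       [gam x]. *)
    rewrite (@H1_null_sub _ _ _ _ [set gam x])//.
      move=> _ [[t [Pt xt] <-] _] /=; apply: (metric_eq0 hd).
      apply/eqP; rewrite eq_le (metric_ge0 hd) andbT.
      apply: (le_trans (gamlip Pt Px)).
      have /eqP -> : sig t == sig x by rewrite eq_le andbC.
      by rewrite subrr normr0 mulr0.
    by apply: (H1_null_dist0 hd) => u v /= -> ->.
move=> [Px yx yw]; have Py := chain_head yw.
have [n [S [h [len [[h1 h2 h0 h3] hsum hH]]]]] := ih _ yw.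
pose v := arc_length; pose z := last y w.
pose e := v x - v y - d (gam x) (gam y).
have e0 : 0 <= e by have := arc_length_add Py Px yx; rewrite /e /v; lra.
pose P' := [set t | P t /\ (sig y <= sig t <= sig x)%R].
pose phi t := d (gam t) (gam y).
have ylen t : P' t -> 0 <= phi t <= v t - v y.
  move=> [Pt /andP[yt _]]; rewrite (metric_ge0 hd)/=.
  by have := arc_length_add Py Pt yt; rewrite /v /phi; lra.
have xlen t : P' t -> v t + d (gam x) (gam t) <= v x.
  by move=> [Pt /andP[_ tx]]; exact: arc_length_add.
have bad : (H1 d (gam @` [set t | P' t /\ exists2 s, P' s &
    (`|phi s - phi t| < (1 - eta) * `|v s - v t|)%R]) <= (10 * e / eta)%:E)%E.
  apply: H1_nonexpanding_part => //.
  - by move=> s t [Ps _] [Pt _]; exact: dist_le_arc_length.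
  - move=> s t [Ps _] [Pt _]; apply: le_trans (dist_le_arc_length Ps Pt).
    exact: metric_lip.
  - move=> s t P's P't _; have := xlen _ P't; have /andP[_] := ylen _ P's.
    by have := metric_tri hd (gam t) (gam x) (gam y); rewrite /e /phi; lra.
pose S0 := gam @` [set t | P' t /\ forall s, P' s ->
  (1 - eta) * `|v s - v t| <= `|phi s - phi t|].
exists n.+1, (fun i => if i is j.+1 then S j else S0),
  (fun i => if i is j.+1 then h j else fun u => d u (gam y)),
  (fun i => if i is j.+1 then len j else v x - v y); split.
- split.
  + by case=> [|i]// u u'; exact: metric_lip.
  + case=> [|i]//; last exact: h2.
    move=> _ _ [t [P't ht] <-] [s [P's hs] <-].
    apply: le_trans (hs t P't); rewrite ler_wpM2l ?subr_ge0 ?(ltW eta1)//.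
    exact: dist_le_arc_length P't.1 P's.1.
  + case=> [|i]; last exact: h0.
    have := arc_length_add Py Px yx; have := metric_ge0 hd (gam x) (gam y).
    by rewrite -/v; lra.
  + case=> [|i] u; last exact: h3.
    move=> _ [t [P't _] <-]; have /andP[t0 t1] := ylen _ P't.
    by have := xlen _ P't; have := metric_ge0 hd (gam x) (gam t); rewrite /phi in t0 t1; rewrite t0 /=; lra.
- by rewrite big_ord_recl /= -/v; move: hsum; rewrite -/v -/z; lra.
- pose A := gam @` [set t | P t /\ (sig z <= sig t <= sig y)%R] `\`
      \bigcup_(i < n) S i.
  pose B := gam @` [set t | P' t /\ exists2 s, P' s &
    (`|phi s - phi t| < (1 - eta) * `|v s - v t|)%R].
  apply: (@le_trans _ _ (H1 d A + H1 d B)%E).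
    apply: H1_sub_le => _ [[t [Pt /andP[zt tx]] <-] nS].
    have [ty|/ltW yt] := leP (sig t) (sig y).
      left; split; first by exists t => //; split => //; apply/andP; split.
      by move=> [i /= ni Si]; apply: nS; exists i.+1.
    have P't : P' t by split => //; apply/andP; split.
    right; exists t => //; split => //; apply: contrapT => /forall2NP hN.
    apply: nS; exists 0%N => //; exists t => //; split => // s P's.
    by have [//|/negP] := hN s; rewrite -leNgt.
  apply: (le_trans (leeD hH bad)); rewrite -EFinD lee_fin -mulrDl.
  rewrite ler_pM2r ?invr_gt0// /e /v; lra.
Qed.

(** A chain of length within [eps] of the supremum of arc lengths leaves a polygon deficit below
    [eps], and the portions of the curve beyond its two ends also have arc length at most [eps]. *)
Lemma arc_decomposition (eta kap : R) : 0 < eta < 1 -> 0 < kap -> l <= r ->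
  exists n S h len, [/\ almost_isometric_family eta n S h len,
    \sum_(i < n) len i <= L * (r - l) &
    (H1 d (gam @` P `\` \bigcup_(i < n) S i) <= kap%:E)%E].
Proof.
move=> eta01 kap0 lr; have /andP[eta0 eta1] := eta01.
have Lrl : 0 <= L * (r - l) by rewrite mulr_ge0 ?subr_ge0// ltW.
have [[t0 Pt0]|noP] := pselect (exists t, P t); last first.
  exists 0%N, (fun=> set0), (fun=> fun=> 0), (fun=> 0); split.
  - by split => // i u v; rewrite subrr normr0 metric_ge0.
  - by rewrite big_ord0.
  - rewrite (_ : _ `\` _ = set0) ?H1_set0 ?lee_fin ?(ltW kap0)//.
    by rewrite -subset0 => u [[t Pt] _]; exfalso; apply: noP; exists t.
pose v := arc_length; pose VP := [set v t | t in P].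
have VPub : has_ubound VP.
  exists (L * (r - l)) => _ [t Pt <-]; apply: (le_trans (arc_length_le Pt)).
  by rewrite ler_pM2l// lerD2r; have /andP[] := Plr Pt.
have VPsup : has_sup VP by split => //; exists (v t0), t0.
(* The solution of [10 * eps / eta + 2 * eps = kap]: the middle part costs the first term, the two
   ends [eps] each. *)
pose eps := kap * eta / (10 + 2 * eta).
have den0 : 0 < 10 + 2 * eta by lra.
have eps0 : 0 < eps by rewrite divr_gt0// mulr_gt0.
have epsE : 10 * eps / eta + 2 * eps = kap.
  by rewrite /eps; field; rewrite !gt_eqF.
have eps20 : 0 < eps / 2 by lra.
have [_ [x' Px' <-] xsup'] := sup_adherent eps20 VPsup.
have [_ [w xw ->] xsup] := @sup_adherent _ _ _ eps20 (has_sup_length Px').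
have {xsup' xsup} long : sup VP - eps < chain_length x' w.
  by move: xsup xsup'; rewrite -/(arc_length x') -/v; lra.
pose z := last x' w.
have [n [S [h [len [fam hsum hH]]]]] := chain_decomposition eta01 xw.
have Pz : P z.
  by rewrite /z; elim: w x' xw {Px' long z hsum hH} => [|s w ih] x //= [_ _ /ih].
have vz0 : 0 <= v z := arc_length_ge0 Pz.
have xVP t : P t -> v t <= sup VP by move=> Pt; apply: ub_le_sup => //; exists t.
have vx : chain_length x' w <= v x' := le_arc_length xw.
have zlong : v z <= v x' - chain_length x' w.
  rewrite /z /v; elim: w x' xw {Px' long z hsum hH vx Pz vz0} => [|s w ih] x /=.
    by rewrite subr0.
  move=> [Px sx sw]; have := ih _ sw.
  by have := arc_length_add (chain_head sw) Px sx; lra.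
exists n, S, h, len; split => //.
  apply: (le_trans hsum); have := xVP _ Px'; rewrite -/v -/z => h1.
  have : sup VP <= L * (r - l).
    apply: ge_sup; first by case: VPsup.
    move=> _ [t Pt <-]; apply: (le_trans (arc_length_le Pt)).
    by rewrite ler_pM2l// lerD2r; have /andP[] := Plr Pt.
  by lra.
pose A1 := [set t | P t /\ sig t < sig z].
pose A2 := [set t | P t /\ sig x' < sig t].
have lip1 s t : P s -> P t -> d (gam s) (gam t) <= 1 * `|v s - v t|.
  by move=> Ps Pt; rewrite mul1r; exact: dist_le_arc_length.
have HA1 : (H1 d (gam @` A1) <= (1 * (eps - 0))%:E)%E.
  apply: (@H1_image_interval _ _ _ _ _ _ v) => //; first exact: ltW.
    by move=> s t [Ps _] [Pt _]; exact: lip1.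
  move=> s [Ps sz]; rewrite (arc_length_ge0 Ps)/=.
  have := arc_length_add Ps Pz (ltW sz); have := metric_ge0 hd (gam z) (gam s).
  by have := xVP _ Px'; rewrite /v in zlong long vx *; lra.
have HA2 : (H1 d (gam @` A2) <= (1 * (sup VP - (sup VP - eps)))%:E)%E.
  apply: (@H1_image_interval _ _ _ _ _ _ v) => //; first by lra.
    by move=> s t [Ps _] [Pt _]; exact: lip1.
  move=> s [Ps sz]; rewrite xVP// andbT.
  have := arc_length_add Px' Ps (ltW sz); have := metric_ge0 hd (gam s) (gam x').
  by rewrite /v in zlong long vx *; lra.
rewrite -epsE EFinD.
pose M := gam @` [set t | P t /\ (sig z <= sig t <= sig x')%R] `\`
  \bigcup_(i < n) S i.
apply: (@le_trans _ _ (H1 d M + H1 d (gam @` A1 `|` gam @` A2))%E).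
  apply: H1_sub_le => _ [[t Pt <-] nS].
  have [zt|tz] := leP (sig z) (sig t); last by right; left; exists t.
  have [tx|xt] := leP (sig t) (sig x'); last by right; right; exists t.
  by left; split => //; exists t => //; split => //; apply/andP; split.
apply: leeD.
  apply: (le_trans hH); rewrite lee_fin ler_pM2r ?invr_gt0// -/v.
  by have := xVP _ Px'; rewrite -/z; rewrite /v in long vx vz0 *; lra.
apply: (le_trans (H1U_le _ _ _)); apply: (le_trans (leeD HA1 HA2)).
by rewrite -EFinD lee_fin; lra.
Qed.

End Arc.
End ArcDecomposition.

(** * Families of almost isometric pieces *)

Section Families.
Variables (R : realType) (X : Type) (d : X -> X -> R).
Hypothesis hd : is_metric d.

Lemma family_closure eta n S h len : 0 <= eta <= 1 ->
  almost_isometric_family d eta n S h len ->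
  almost_isometric_family d eta n (fun i => mclosure d (S i)) h len.
Proof.
move=> /andP[eta0 eta1] [h1 h2 h0 h3]; split => //.
- move=> i x y clx cly; apply/ler_addgt0Pr => e e0.
  have e4 : 0 < e / 4 by lra.
  have [x' Sx xx] := clx _ e4; have [y' Sy yy] := cly _ e4.
  have hx := h1 i x' x; have hy := h1 i y y'; have hxy := h2 i _ _ Sx Sy.
  have t1 := metric_tri hd x' x y; have t2 := metric_tri hd y' x' y.
  have t3 : `|h i x' - h i y'| <= `|h i x' - h i x| + `|h i x - h i y| + `|h i y - h i y'|.
    by apply: (le_trans (ler_distD (h i y) _ _)); rewrite lerD2r ler_distD.
  rewrite (metric_sym hd x' x) in hx; rewrite (metric_sym hd y' y) in t2.
  have : (1 - eta) * d x y <= (1 - eta) * (d x' y' + (d x x' + d y y')).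
    by rewrite ler_wpM2l ?subr_ge0//; lra.
  have : (1 - eta) * (d x x' + d y y') <= 1 * (d x x' + d y y').
    by rewrite ler_wpM2r ?addr_ge0 ?(metric_ge0 hd)//; lra.
  by rewrite mulrDr; lra.
- move=> i x ni clx.
  have main e : 0 < e -> - e <= h i x <= len i + e.
    move=> e0; have [y Sy xy] := clx _ e0; have /andP[y0 yl] := h3 _ _ ni Sy.
    by have := h1 i x y; rewrite ler_norml => /andP[? ?]; apply/andP; split; lra.
  apply/andP; split.
    by apply/ler_addgt0Pr => e /main/andP[]; lra.
  by apply/ler_addgt0Pr => e /main/andP[].
Qed.

Lemma family_sub eta n S h len S' : (forall i, S' i `<=` S i) ->
  almost_isometric_family d eta n S h len ->
  almost_isometric_family d eta n S' h len.
Proof.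
move=> S'S [h1 h2 h0 h3]; split => //.
- by move=> i x y /S'S Sx /S'S Sy; exact: h2.
- by move=> i x ni /S'S Sx; exact: h3.
Qed.

Lemma family_cat eta n1 S1 h1 len1 n2 S2 h2 len2 :
  almost_isometric_family d eta n1 S1 h1 len1 ->
  almost_isometric_family d eta n2 S2 h2 len2 ->
  exists S h len,
    [/\ almost_isometric_family d eta (n1 + n2)%N S h len,
        \sum_(i < n1 + n2) len i = \sum_(i < n1) len1 i + \sum_(i < n2) len2 i,
        \bigcup_(i < n1) S1 i `<=` \bigcup_(i < (n1 + n2)%N) S i &
        \bigcup_(i < n2) S2 i `<=` \bigcup_(i < (n1 + n2)%N) S i].
Proof.
move=> [a1 b1 l1 c1] [a2 b2 l2 c2].
exists (fun i => if (i < n1)%N then S1 i else S2 (i - n1)%N),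
  (fun i => if (i < n1)%N then h1 i else h2 (i - n1)%N),
  (fun i => if (i < n1)%N then len1 i else len2 (i - n1)%N); split.
- split.
  + by move=> i x y; case: ifP.
  + by move=> i x y; case: ifP => _; [exact: b1|exact: b2].
  + move=> i n12; have [n1i|n1i] := ltnP i n1; first exact: l1.
    by apply: l2; rewrite ltn_subLR.
  + move=> i x n12; have [n1i|n1i] := ltnP i n1; first exact: c1.
    by apply: c2; rewrite ltn_subLR.
- rewrite big_split_ord /=; congr (_ + _); apply: eq_bigr => i _ /=.
    by rewrite ltn_ord.
  by rewrite ltnNge leq_addr /= addKn.
- move=> x [i /= ni Si]; exists i => /=; last by rewrite ni.
  exact: leq_trans ni (leq_addr _ _).
- move=> x [i /= ni Si]; exists (n1 + i)%N => /=; first by rewrite ltn_add2l.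
  by rewrite ltnNge leq_addr /= addKn.
Qed.

(** The Lipschitz curves are decomposed once with the fixed value [2^-1] of [eta], which yields
    countably many closed sets with a bi-Lipschitz coordinate; finer decompositions start from
    these. *)
Lemma half_decomposition (E : set X) : rectifiable1 d E ->
  exists (C : nat -> set X) (h : nat -> X -> R) (len : nat -> R), [/\ forall i, mclosed d (C i),
    forall i x y, `|h i x - h i y| <= d x y,
    forall i x y, C i x -> C i y -> d x y <= 2 * `|h i x - h i y|,
    forall i x, C i x -> 0 <= h i x <= len i &
    H1 d (E `\` \bigcup_i C i) = 0%E].
Proof.
move=> [_ [A [g [glip E0]]]].
have half01 : 0 < (2^-1 : R) < 1 by apply/andP; split; lra.
(* Bounded parameter sets, as [arc_decomposition] requires. *)
pose PA (p : nat * nat) := A p.1 `&` [set t : R | - p.2%:R <= t <= p.2%:R].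
have /choice[q qP] : forall p : nat * nat * nat,
    exists q : nat * (nat -> set X) * (nat -> X -> R) * (nat -> R),
    almost_isometric_family d 2^-1 q.1.1.1 q.1.1.2 q.1.2 q.2 /\
    (H1 d (g p.1.1 @` PA p.1 `\` \bigcup_(i < q.1.1.1) q.1.1.2 i) <=
      (p.2.+1%:R^-1)%:E)%E.
  move=> [[i m] k] /=; have [L gL] := glip i.
  have [||||||n [S [h [len [fam _ hH]]]]] := @arc_decomposition R X d hd R (PA (i, m))
    (g i) id (Num.max L 1) (- m%:R) m%:R _ _ _ 2^-1 k.+1%:R^-1.
  - by rewrite lt_max ltr01 orbT.
  - by move=> t [].
  - move=> s t [As _] [At _]; apply: (le_trans (gL s t As At)).
    by rewrite ler_wpM2r// le_max lexx.
  - by [].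
  - exact: natSinv_gt0.
  - by rewrite -subr_ge0 opprK addr_ge0.
  - by exists (n, S, h, len).
(* Indices [(i, m, k, j)]: curve, parameter bound, error [k.+1%:R^-1] and piece. Codes that name no
   piece get the empty set. *)
pose idx (i : nat) : option (nat * nat * nat * nat) := unpickle i.
exists (fun i => if idx i is Some (p, j) then
    (if (j < (q p).1.1.1)%N then mclosure d ((q p).1.1.2 j) else set0) else set0),
  (fun i => if idx i is Some (p, j) then (q p).1.2 j else fun=> 0),
  (fun i => if idx i is Some (p, j) then (q p).2 j else 0).
have half01' : 0 <= (2^-1 : R) <= 1 by apply/andP; split; lra.
have fam p := family_closure half01' (qP p).1.
split.
- move=> i; case: (idx i) => [[p j]|]; last by move=> x /(_ 1 ltr01)[].
  by case: ifP => _; [exact: mclosure_closed|move=> x /(_ 1 ltr01)[]].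
- move=> i x y; case: (idx i) => [[p j]|]; last by rewrite subrr normr0 metric_ge0.
  by have [h1 _ _ _] := fam p; exact: h1.
- move=> i x y; case: (idx i) => [[p j]|]//; case: ifP => // _ Cx Cy.
  by have [_ h2 _ _] := fam p; have := h2 _ _ _ Cx Cy; lra.
- move=> i x; case: (idx i) => [[p j]|]//; case: ifP => // jn Cx.
  by have [_ _ _ h3] := fam p; exact: h3.
set C := (fun i => if idx i is Some _ then _ else _).
pose rest i m k := g i @` PA (i, m) `\` \bigcup_(j < (q (i, m, k)).1.1.1) (q (i, m, k)).1.1.2 j.
(* A point of a curve in no piece is missed at every error level [k], so such points form a null
   set. *)
have cover : E `\` \bigcup_i C i `<=`
    (E `\` \bigcup_i (g i @` A i)) `|` \bigcup_i \bigcup_m \bigcap_k rest i m k.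
  move=> x [Ex nC]; have [[i _ [t At gt]]|] := pselect ((\bigcup_i (g i @` A i)) x).
    right; exists i => //; exists (Num.trunc `|t|).+1 => // k _; split.
      exists t => //; split => //=; rewrite -ler_norml ltW//.
      exact: truncnS_gt.
    move=> [j /= jn Sj]; apply: nC.
    exists (pickle (i, (Num.trunc `|t|).+1, k, j)) => //.
    by rewrite /C /idx pickleK jn; exact: sub_mclosure.
  by left.
apply: (H1_null_sub cover); apply/eqP; rewrite eq_le H1_ge0 andbT.
apply: (le_trans (H1U_le _ _ _)); rewrite E0 add0e.
rewrite H1_null_bigcup// => i; rewrite H1_null_bigcup// => m.
apply: H1_nullP => e e0; have [k ke] := ex_natSinv_lt e0.
apply: (@le_trans _ _ (H1 d (rest i m k))); first by apply: le_H1 => x /(_ k I).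
by apply: (le_trans (qP (i, m, k)).2); rewrite lee_fin ltW.
Qed.

(** Each [C i] is itself an arc with parameter [h i] and Lipschitz constant [2], so the bound on the
    total length is independent of [eta]. *)
Lemma finite_decomposition (eta kap : R) (C : nat -> set X) (h : nat -> X -> R) (len : nat -> R) M :
  0 < eta < 1 -> 0 < kap ->
  (forall i x y, `|h i x - h i y| <= d x y) ->
  (forall i x y, C i x -> C i y -> d x y <= 2 * `|h i x - h i y|) ->
  (forall i x, C i x -> 0 <= h i x <= len i) ->
  exists n S h' len', [/\ almost_isometric_family d eta n S h' len',
    \sum_(i < n) len' i <= \sum_(i < M) 2 * `|len i| &
    (H1 d (\bigcup_(i < M) C i `\` \bigcup_(i < n) S i) <= (M%:R * kap)%:E)%E].
Proof.
move=> eta01 kap0 h1 h2 h3; elim: M => [|M [n [S [h' [len' [fam sum HM]]]]]].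
  exists 0%N, (fun=> set0), (fun=> fun=> 0), (fun=> 0); split.
  - by split => // i u v; rewrite subrr normr0 metric_ge0.
  - by rewrite !big_ord0.
  - rewrite (_ : _ `\` _ = set0) ?H1_set0 ?mul0r//.
    by rewrite -subset0 => x [[]].
have [||||||n2 [S2 [h2' [len2 [fam2 sum2 H2]]]]] := @arc_decomposition R X d hd X (C M)
    id (h M) 2 0 `|len M| _ _ _ eta kap => //.
- by move=> t /h3 /andP[-> tl] /=; apply: (le_trans tl); exact: ler_norm.
- by move=> s t; exact: h2.
have [S'' [h'' [len'' [fam'' sum'' sub1 sub2]]]] := family_cat fam fam2.
exists (n + n2)%N, S'', h'', len''; split => //.
  by rewrite sum'' big_ord_recr /= subr0 in sum2 *; exact: lerD.
apply: (@le_trans _ _ ((M%:R * kap)%:E + kap%:E)%E); last first.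
  by rewrite -EFinD lee_fin -natr1 mulrDl mul1r.
apply: le_trans (leeD HM H2); apply: H1_sub_le => x [[i /= iM Ci] nS].
move: iM; rewrite ltnS leq_eqVlt => /predU1P[iM|iM].
  right; split; first by exists x => //; rewrite -iM.
  by move=> /sub2.
by left; split; [exists i|move=> /sub1].
Qed.

End Families.

(** * Separated pieces of a rectifiable set *)

Section RectifiableDecomposition.
Variables (R : realType) (disp : measure_display) (X : measurableType disp).
Variables (d : X -> X -> R) (mu : {measure set X -> \bar R}).
Hypothesis hmeas : forall A : set X, measurable A <-> H1_measurable d A.
Hypothesis hmu : forall A : set X, measurable A -> mu A = H1 d A.
Hypothesis hd : is_metric d.

(* The bound [Lam] on the total length does not depend on [eta]: the pieces for
   [eta] subdivide a fixed finite family of arcs. *)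
Lemma rectifiable_decomposition (E : set X) (kap : R) :
  rectifiable1 d E -> (H1 d E < +oo)%E -> 0 < kap ->
  exists Lam : R, 0 <= Lam /\ forall eta, 0 < eta < 1 ->
  exists n S h len rho, [/\ almost_isometric_family d eta n S h len,
    \sum_(i < n) len i <= Lam, 0 < rho,
    forall i j x y, i <> j -> S i x -> S j y -> rho <= d x y &
    (H1 d (E `\` \bigcup_(i < n) S i) < kap%:E)%E].
Proof.
move=> rE Efin kap0; have mE : measurable E by apply/hmeas; case: rE.
have [C [h [len [cC h1 h2 h3 E0]]]] := half_decomposition hd rE.
have kap3 : 0 < kap / 3 by lra.
(* One of three losses of [kap / 3]; [M] is fixed before [eta]. The others come from decomposing the
   [C i] and from separating the pieces. *)
have [||M HM] := @H1_exhaust _ _ _ _ _ hmu E (E `\` \bigcup_i C i) C (kap / 3)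
    mE Efin E0 _ _ kap3.
- by move=> n; apply: (mclosed_measurable hmeas hd); exact: cC.
- by move=> x Ex; have [|nC] := pselect ((\bigcup_i C i) x); [right|left].
exists (\sum_(i < M) 2 * `|len i|); split.
  by apply: sumr_ge0 => i _; rewrite mulr_ge0.
move=> eta eta01; have kapM : 0 < kap / 3 / M.+1%:R by rewrite divr_gt0.
have [n [S [h' [len' [fam sum HC]]]]] :=
  finite_decomposition hd M eta01 kapM h1 h2 h3.
have [|T [rho [rho0 [cT TS Tsep HT]]]] := @separated_exhaust _ _ _ _ _ hmeas hmu hd
  E (fun i => mclosure d (S i)) n _ mE Efin _ kap3.
  by move=> i; exact: mclosure_closed.
have eta01' : 0 <= eta <= 1 by case/andP: eta01 => a b; rewrite !ltW.
exists n, T, h', len', rho; split => //.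
  exact: family_sub TS (family_closure hd eta01' fam).
pose B := \bigcup_(i < M) C i `\` \bigcup_(i < n) S i.
apply: (@le_lt_trans _ _ (H1 d (E `\` \bigcup_(i < M) C i) + (H1 d B +
  H1 d ((E `&` \bigcup_(i < n) mclosure d (S i)) `\` \bigcup_(i < n) T i)))%E).
  apply: (@le_trans _ _ (H1 d (E `\` \bigcup_(i < M) C i) + H1 d (B `|`
    ((E `&` \bigcup_(i < n) mclosure d (S i)) `\` \bigcup_(i < n) T i)))%E).
    apply: H1_sub_le => x [Ex nT].
    have [CM|nC] := pselect ((\bigcup_(i < M) C i) x); last by left.
    right; have [[i /= ni Si]|nS] := pselect ((\bigcup_(i < n) S i) x).
      by right; split => //; split => //; exists i => //; exact: sub_mclosure.
    by left.
  by rewrite leeD2l// H1U_le.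
have HB : (H1 d B <= (kap / 3)%:E)%E.
  apply: (le_trans HC); rewrite lee_fin mulrCA ger_pMr//.
  by rewrite ler_pdivrMr ?ltr0n// mul1r ler_nat.
have -> : kap%:E = ((kap / 3)%:E + ((kap / 3)%:E + (kap / 3)%:E))%E.
  by rewrite -!EFinD; congr EFin; lra.
apply: lte_leD => //; first by rewrite ge0_fin_numE ?addr_ge0 ?adde_ge0 ?H1_ge0//; exact: (le_lt_trans (leeD HB (ltW HT))) (ltry _).
by apply: leeD => //; exact: ltW.
Qed.

End RectifiableDecomposition.

(** * Supremum distance and finite minima *)

Section SupDist.
Variables (R : realType) (X : Type).

Lemma supdist_ge (f g : X -> R) x : (`|f x - g x|%:E <= supdist f g)%E.
Proof. by apply: ereal_sup_ubound; exists x. Qed.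

Lemma supdist_lt (f g : X -> R) (c r : R) : c < r ->
  (forall x, `|f x - g x| <= c) -> (supdist f g < r%:E)%E.
Proof.
move=> cr h; apply: (@le_lt_trans _ _ c%:E); last by rewrite lte_fin.
by apply: ge_ereal_sup => _ [x _ <-]; rewrite lee_fin.
Qed.

Lemma finite_min (J : finType) (P : pred J) (u0 : X -> R) (u : J -> X -> R) :
  exists m : X -> R, [/\ forall x, m x <= u0 x,
    forall j x, P j -> m x <= u j x &
    forall x, m x = u0 x \/ exists2 j, P j & m x = u j x].
Proof.
exists (fun x => \big[Num.min/u0 x]_(j | P j) u j x); split.
- by move=> x; exact: bigmin_le_id.
- by move=> j x Pj; exact: bigmin_le_cond.
- move=> x; apply: (big_ind (fun z => z = u0 x \/ exists2 j, P j & z = u j x)).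
  + by left.
  + by move=> a b ha hb; rewrite /Num.min; case: ifP.
  + by move=> j Pj; right; exists j.
Qed.

Lemma min_lip1 (d : X -> X -> R) (J : finType) (P : pred J) (u0 : X -> R)
    (u : J -> X -> R) (m : X -> R) :
  (forall x, m x <= u0 x) -> (forall j x, P j -> m x <= u j x) ->
  (forall x, m x = u0 x \/ exists2 j, P j & m x = u j x) ->
  (forall x y, d x y = d y x) ->
  (forall x y, `|u0 x - u0 y| <= d x y) ->
  (forall j x y, P j -> `|u j x - u j y| <= d x y) ->
  forall x y, `|m x - m y| <= d x y.
Proof.
move=> m0 mj att dC lip0 lipj x y.
have half a b : m a - m b <= d a b.
  case: (att b) => [->|[j Pj ->]].
    by have := lip0 a b; rewrite ler_norml => /andP[_]; have := m0 a; lra.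
  by have := lipj j a b Pj; rewrite ler_norml => /andP[_]; have := mj j a Pj; lra.
rewrite ler_norml; have := half x y; have := half y x; rewrite dC.
by move=> h1 h2; apply/andP; split; lra.
Qed.

End SupDist.

(** * The open sets of nearly unit speed functions *)

Section NearlyIsometricFunctions.
Variables (R : realType) (X : Type) (d : X -> X -> R).
Hypothesis hd : is_metric d.
Variable E : set X.

(* As [tau i] dominates distances on [S i], it bounds the increments of a
   [1]-Lipschitz [g]; these may fall short by [e] in total, at any scale. *)
Definition unit_speed_family (g : X -> R) (e : R)
    (S : nat -> set X) (tau : nat -> X -> R) : Prop :=
  (forall i x y, S i x -> S i y -> d x y <= `|tau i x - tau i y|) /\
  (forall i x y, S i x -> S i y -> tau i x <= tau i y ->
    (tau i y - tau i x) - (g y - g x) <= e).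

Definition nearly_unit_speed (theta : R) : set (X -> R) :=
  [set g | Lip1 d g /\ exists (e : R) (N : nat) S tau,
    [/\ unit_speed_family g e S tau, 0 <= e, N%:R * e < theta &
        (H1 d (E `\` \bigcup_(i < N) S i) < theta%:E)%E]].

(** A perturbation smaller than [r] raises the error of each piece by at most [2 * r], and the
    strict bound on [N%:R * e] leaves room for [N] such increases. *)
Lemma nearly_unit_speed_open theta : open_in_Lip1 d (nearly_unit_speed theta).
Proof.
split; first by move=> g [].
move=> g [gL [e [N [S [tau [[h1 h2] e0 Ne HS]]]]]].
pose r := (theta - N%:R * e) / (N.+1%:R * 2).
have r0 : 0 < r by rewrite divr_gt0 ?subr_gt0// mulr_gt0.
exists r; split => // g' g'L gg'; split => //.
have close x : `|g x - g' x| < r.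
  by rewrite -lte_fin; apply: le_lt_trans gg'; exact: supdist_ge.
exists (e + r * 2), N, S, tau; split => //.
- split => // i x y Sx Sy xy; have := h2 _ _ _ Sx Sy xy.
  have := close x; have := close y; rewrite !ltr_norml => /andP[? ?] /andP[? ?].
  by lra.
- by rewrite addr_ge0// mulr_ge0// ltW.
- have -> : N%:R * (e + r * 2) = N%:R * e + (theta - N%:R * e) * (N%:R / N.+1%:R).
    by rewrite /r; field; rewrite nat1r pnatr_eq0.
  have : (theta - N%:R * e) * (N%:R / N.+1%:R) < theta - N%:R * e.
    rewrite gtr_pMr ?subr_gt0// ltr_pdivrMr ?ltr0n// mul1r ltr_nat.
    exact: ltnSn.
  by rewrite -ltrBrDl.
Qed.

Lemma H1_finite_cover (B : set X) (A : nat -> set X) (N : nat) (c : R) :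
  B `<=` \bigcup_(i < N) A i -> (forall i, (H1 d (A i) <= c%:E)%E) ->
  (H1 d B <= (N%:R * c)%:E)%E.
Proof.
move=> BA Ac; apply: (le_trans (le_H1 d BA)) => {B BA}.
elim: N => [|N ih].
  rewrite mul0r (_ : \bigcup_(i < 0) A i = set0) ?H1_set0//.
  by rewrite -subset0 => x [].
apply: (@le_trans _ _ ((N%:R * c)%:E + c%:E)%E); last first.
  by rewrite -EFinD lee_fin -natr1 mulrDl mul1r.
apply: le_trans (leeD ih (Ac N)); apply: H1_sub_le => x [i /= + Ai].
rewrite ltnS leq_eqVlt => /predU1P[<-|iN]; first by right.
by left; exists i.
Qed.

(** [H1_nonexpanding_part] removes measure [10 * e / lam] from each of the [N] pieces, in total at
    most [10 * theta / lam]. *)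
Lemma unit_speed_expanding (lam : R) (theta : R) g : 0 < lam ->
  nearly_unit_speed theta g ->
  exists G : nat -> set X,
    (forall i x y, G i x -> G i y -> (1 - lam) * d x y <= `|g x - g y|) /\
    (H1 d (E `\` \bigcup_i G i) <= (theta + 10 * theta / lam)%:E)%E.
Proof.
move=> lam0 [[_ gL] [e [N [S [tau [[h1 h2] e0 Ne HS]]]]]].
(* For [lam > 1] the factor [1 - lam] is negative and the whole space qualifies. *)
have [lam1|lam1] := leP lam 1; last first.
  exists (fun=> setT); split.
    move=> _ x y _ _; apply: (@le_trans _ _ 0) => //.
    by rewrite mulr_le0_ge0 ?(metric_ge0 hd)//; lra.
  rewrite (_ : _ `\` _ = set0); last by rewrite -subset0 => x [_]; apply; exists 0%N.
  rewrite H1_set0 lee_fin.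
  have : 0 < theta by apply: le_lt_trans Ne; rewrite mulr_ge0.
  by move=> t0; rewrite addr_ge0 ?divr_ge0 ?mulr_ge0 ?ltW.
pose Bad i := [set t | S i t /\ exists2 s, S i s &
  (`|g s - g t| < (1 - lam) * `|tau i s - tau i t|)%R].
pose G i := S i `\` Bad i.
exists G; split.
  move=> i x y [Sx nx] [Sy ny]; apply: (@le_trans _ _ ((1 - lam) * `|tau i x - tau i y|)).
    by rewrite ler_wpM2l ?subr_ge0// h1.
  by rewrite leNgt; apply/negP => h; apply: ny; split => //; exists x.
have badH i : (H1 d (Bad i) <= (10 * e / lam)%:E)%E.
  rewrite -[Bad i]image_id; apply: H1_nonexpanding_part => //.
  - by move=> s t; exact: h1.
  - by move=> s t Ss St; apply: le_trans (gL s t) _; exact: h1.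
  - by move=> s t; exact: h2.
apply: (@le_trans _ _ (H1 d (E `\` \bigcup_(i < N) S i) +
  H1 d (\bigcup_(i < N) Bad i))%E).
  apply: H1_sub_le => x [Ex nG].
  have [[i /= iN Si]|nS] := pselect ((\bigcup_(i < N) S i) x); last by left.
  right; exists i => //; apply: contrapT => nB; apply: nG.
  by exists i.
rewrite EFinD; apply: leeD; first exact: ltW.
apply: (le_trans (H1_finite_cover (fun x h => h) badH)).
rewrite lee_fin !mulrA ler_pM2r ?invr_gt0//.
by rewrite mulrAC mulrC ler_pM2l//; lra.
Qed.

(** The pieces for all [theta = n.+1%:R^-1] are collected; what they miss has measure at most a
    multiple of each of these numbers. *)
Lemma expanding_exhaustion g (lam : R) : 0 < lam ->
  (forall n : nat, nearly_unit_speed n.+1%:R^-1 g) ->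
  exists G : nat -> set X,
    (forall i x y, G i x -> G i y -> (1 - lam) * d x y <= `|g x - g y|) /\
    H1 d (E `\` \bigcup_i G i) = 0%E.
Proof.
move=> lam0 gU.
have /choice[G GP] n := unit_speed_expanding lam0 (gU n).
have /card_esym/ppcard_eqP[f] := card_nat2.
exists (fun k => G (f k).1 (f k).2); split.
  by move=> k; exact: (GP (f k).1).1.
apply: H1_nullP => e e0.
have den0 : 0 < 1 + 10 / lam by rewrite addr_gt0// divr_gt0.
have [n ne] : exists n : nat, n.+1%:R^-1 < e / (1 + 10 / lam).
  by apply: ex_natSinv_lt; rewrite divr_gt0.
apply: (@le_trans _ _ (H1 d (E `\` \bigcup_i G n i))).
  apply: le_H1 => x [Ex nG]; split => // -[i _ Gi]; apply: nG.
  by exists (f^-1%FUN (n, i)) => //=; rewrite invK ?inE.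
apply: (le_trans (GP n).2); rewrite lee_fin.
rewrite ltr_pdivlMr// in ne; move: ne; rewrite mulrDr mulr1 mulrCA mulrA.
exact: ltW.
Qed.

End NearlyIsometricFunctions.

(** * Density of the nearly unit speed functions *)

Section Density.
Variables (R : realType) (disp : measure_display) (X : measurableType disp).
Variables (d : X -> X -> R) (mu : {measure set X -> \bar R}).
Hypothesis hmeas : forall A : set X, measurable A <-> H1_measurable d A.
Hypothesis hmu : forall A : set X, measurable A -> mu A = H1 d A.
Hypothesis hd : is_metric d.

Lemma unit_speed_finType (E : set X) (I : finType) (g : X -> R) (e theta : R)
    (S : I -> set X) (tau : I -> X -> R) : Lip1 d g ->
  (forall i x y, S i x -> S i y -> d x y <= `|tau i x - tau i y|) ->
  (forall i x y, S i x -> S i y -> tau i x <= tau i y ->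
    (tau i y - tau i x) - (g y - g x) <= e) ->
  0 <= e -> #|I|%:R * e < theta ->
  (H1 d (E `\` \bigcup_i S i) < theta%:E)%E ->
  nearly_unit_speed d E theta g.
Proof.
move=> gL h1 h2 e0 Ie HS; split => //.
pose S' k := if insub k : option 'I_#|I| is Some o then S (enum_val o) else set0.
pose tau' k := if insub k : option 'I_#|I| is Some o then tau (enum_val o)
  else fun=> 0.
exists e, #|I|, S', tau'; split => //.
  split => k x y; rewrite /S' /tau'; move: (insub k : option 'I_#|I|) => [m|]//.
    exact: h1.
  exact: h2.
apply: le_lt_trans HS; apply: le_H1 => x [Ex nS]; split => // -[i _ Si].
apply: nS; exists (enum_rank i) => /=; first exact: ltn_ord.
by rewrite /S' valK /= enum_rankK.
Qed.

(* Here [k * H] is the coordinate along the piece: it dominates distances, and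
   [k - 1] is of order [eta]. *)
Lemma distance_unit_speed (H g : X -> R) (p x y : X) (fp eta k D : R) :
  0 < eta <= 1 / 2 -> k = 1 / (1 - eta) ->
  `|H y - H p| <= d y p ->
  (1 - eta) * d x p <= `|H x - H p| -> H p <= H x -> H p <= H y ->
  g x = fp + d x p -> g y = fp + d y p -> d y p <= D ->
  (k * H y - k * H x) - (g y - g x) <= 2 * eta * D.
Proof.
move=> /andP[eta0 eta2] kE hy hx px py -> -> yD.
rewrite ger0_norm ?subr_ge0// in hy; rewrite ger0_norm ?subr_ge0// in hx.
have eta1 : 0 < 1 - eta by lra.
have k0 : 0 < k by rewrite kE divr_gt0.
have keta : k * (1 - eta) = 1 by rewrite kE mul1r mulVf// gt_eqF.
have k2 : k <= 2 by rewrite kE ler_pdivrMr//; lra.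
have : d x p <= k * (H x - H p).
  by rewrite -[leLHS]mul1r -keta -mulrA ler_pM2l.
have : (k - 1) * (H y - H p) <= 2 * eta * D.
  have k1 : k - 1 = k * eta by move: keta; rewrite mulrBr mulr1; lra.
  apply: ler_pM; rewrite ?k1 ?mulr_ge0 ?subr_ge0 ?(ltW k0) ?(ltW eta0)//.
    by rewrite ler_pM2r.
  by lra.
move: hy; rewrite !mulrBl !mulrBr mul1r; lra.
Qed.

(** A net of mesh [sg] has about [Lam / sg + n] points and costs an error of order [eta * sg / eps]
    at each. The product is of order [eta * (Lam + 1) / eps] whatever [sg <= 1 / n.+1%:R] is, so
    [eta] is fixed first, then [n] and [rho] are obtained, and [sg] comes last. *)
Lemma nearly_unit_speed_dense (E : set X) theta : rectifiable1 d E ->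
  (H1 d E < +oo)%E -> 0 < theta -> dense_in_Lip1 d (nearly_unit_speed d E theta).
Proof.
move=> rE Efin theta0 f [[M0 fM0] fL] r r0.
(* Only a default for [xget]; the maps of rectifiability are total and provide a point of [X]. *)
have [_ [_ [g0 _]]] := rE; pose x0 : X := g0 0%N 0.
pose M := Num.max M0 1.
have M_gt0 : 0 < M by rewrite lt_max ltr01 orbT.
have fM x : `|f x| <= M by rewrite le_max fM0.
pose eps := Num.min (1 / 2) (r / (4 * M)).
have eps0 : 0 < eps by rewrite lt_min !divr_gt0 ?mulr_gt0.
have eps12 : eps <= 1 / 2 by rewrite ge_min lexx.
have epsM : eps * M <= r / 4.
  apply: (@le_trans _ _ (r / (4 * M) * M)).
    by rewrite ler_pM2r// ge_min lexx orbT.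
  by rewrite invfM mulrA -mulrA mulVf ?mulr1// gt_eqF.
pose delta := r / 4; have delta0 : 0 < delta by rewrite divr_gt0.
pose f' x := (1 - eps) * f x.
have f'L x y : `|f' x - f' y| <= (1 - eps) * d x y.
  by rewrite -mulrBr normrM ger0_norm ?ler_wpM2l ?fL//; lra.
have f'f x : `|f x - f' x| <= r / 4.
  rewrite /f' mulrBl mul1r opprB addrC subrK normrM gtr0_norm//.
  by apply: le_trans epsM; rewrite ler_pM2l.
have f'tri x y : f' x <= f' y + (1 - eps) * d x y.
  by have := f'L x y; rewrite ler_norml => /andP[_]; lra.
have [Lam [Lam0 dec]] := rectifiable_decomposition hmeas hmu hd rE Efin theta0.
pose eta := Num.min (1 / 2) (theta * eps / (32 * (Lam + 1))).
have Lam1 : 0 < Lam + 1 by lra.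
have eta0 : 0 < eta by rewrite lt_min !divr_gt0 ?mulr_gt0.
have eta12 : eta <= 1 / 2 by rewrite ge_min lexx.
have etaLam : 16 * eta * (Lam + 1) / eps <= theta / 2.
  have : eta <= theta * eps / (32 * (Lam + 1)) by rewrite ge_min lexx orbT.
  rewrite ler_pdivlMr ?mulr_gt0// => h.
  by rewrite ler_pdivrMr//; lra.
have [|n [S [h [len [rho [[h1 h2 len0 h3] sumlen rho0 sep HS]]]]]] := dec eta.
  by rewrite eta0 /=; lra.
(* The first bound makes [n%:R * sg <= 1]; the second keeps the minimizing net point in the same
   piece, as [D < rho]; the third keeps the minimum below [u0] on the pieces. *)
pose sg := Num.min (1 / n.+1%:R) (Num.min (eps * rho / 8) (delta / 8)).
have sg0 : 0 < sg by rewrite !lt_min !divr_gt0 ?mulr_gt0.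
have sgn : n%:R * sg <= 1.
  have : sg <= 1 / n.+1%:R by rewrite ge_min lexx.
  rewrite ler_pdivlMr// mulrC; apply: le_trans.
  by rewrite ler_pM2r// ler_nat.
have sgrho : 4 * sg / eps < rho.
  have : sg <= eps * rho / 8 by rewrite !ge_min lexx orbT.
  have : 0 < eps * rho by rewrite mulr_gt0.
  by rewrite ltr_pdivrMr// (mulrC rho); lra.
have sgdelta : 4 * sg < delta.
  have : sg <= delta / 8 by rewrite !ge_min lexx !orbT.
  by lra.
pose N i := (Num.trunc (len i / sg)).+1.
pose J : finType := {i : 'I_n & 'I_(N i)}.
pose cell (j : J) := S (tag j) `&`
  [set x | (tagged j)%:R <= h (tag j) x / sg < (tagged j).+1%:R].
pose p j := xget x0 (cell j).
pose P j := `[< exists x, cell j x >].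
have pP j : P j -> cell j (p j) by move=> /asboolP[x jx]; apply: xgetPex; exists x.
(* The cap that keeps [g] close to [f] away from the net. *)
pose u0 x := f' x + delta.
pose u j x := f' (p j) + d x (p j).
have [g [gu0 guj gatt]] := finite_min P u0 u.
have gL x y : `|g x - g y| <= d x y.
  apply: (min_lip1 gu0 guj gatt); first exact: metric_sym.
    move=> a b; rewrite /u0 opprD addrACA subrr addr0.
    by apply: (le_trans (f'L a b)); have := mulr_ge0 (ltW eps0) (metric_ge0 hd a b); lra.
  by move=> j a b _; rewrite /u opprD addrACA subrr add0r; exact: metric_lip.
have f'g x : f' x <= g x.
  case: (gatt x) => [->|[j _ ->]]; first by rewrite /u0 lerDl ltW.
  have := f'tri x (p j); have := metric_ge0 hd x (p j); rewrite /u => a b.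
  by have := mulr_ge0 (ltW eps0) a; lra.
have fg x : `|f x - g x| <= r / 2.
  have := f'f x; have := f'g x; have := gu0 x; rewrite /u0 /delta => a b.
  by rewrite !ler_norml => /andP[c e]; apply/andP; split; lra.
exists g; split; last by apply: (@supdist_lt _ _ _ _ (r / 2)) => //; lra.
(* Since [f'] is [(1 - eps)]-Lipschitz, [u j] exceeds [f'] at [x] by at least [eps * d x (p j)]; on
   the pieces [g] exceeds [f'] by at most [4 * sg], so the minimizing point is within [D]. *)
pose D := 4 * sg / eps.
have D0 : 0 < D by rewrite /D divr_gt0// mulr_gt0.
have etaD : 0 <= 2 * eta * D by apply: ltW; apply: mulr_gt0 D0; rewrite mulr_gt0.
pose k := 1 / (1 - eta).
have eta1 : 0 < 1 - eta by lra.
have k0 : 0 < k by rewrite divr_gt0.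
have keta : k * (1 - eta) = 1 by rewrite /k mul1r mulVf// gt_eqF.
(* The distance to [p j] grows on both sides of [p j]; splitting each piece there and reversing [h]
   on one side makes it increase along [tau]. *)
pose side (b : bool) : R := if b then 1 else -1.
pose piece (jb : J * bool) := [set x | [/\ S (tag jb.1) x, P jb.1,
  g x = u jb.1 x, d x (p jb.1) <= D &
  side jb.2 * h (tag jb.1) (p jb.1) <= side jb.2 * h (tag jb.1) x]].
pose tau (jb : J * bool) x := k * (side jb.2 * h (tag jb.1) x).
have sideN b a a' : `|side b * a - side b * a'| = `|a - a'|.
  by rewrite -mulrBr normrM /side; case: b; rewrite ?normrN normr1 mul1r.
apply: (@unit_speed_finType E (J * bool)%type g (2 * eta * D) theta piece tau).
- split => //; exists (M + r) => x.
  have := fM x; have := fg x; rewrite !ler_norml => /andP[a b] /andP[c e].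
  by apply/andP; split; lra.
- move=> [j b] x y [Sx _ _ _ _] [Sy _ _ _ _]; rewrite /tau -mulrBr normrM sideN.
  rewrite gtr0_norm// -[leLHS]mul1r -keta -mulrA ler_pM2l//; exact: h2.
- move=> [j b] x y [Sx Pj gx dx sx] [Sy _ gy dy sy] _ /=.
  have [Sp _] := pP _ Pj; rewrite /= in Sx Sy gx gy dx dy sx sy.
  apply: (@distance_unit_speed (fun z => side b * h (tag j) z) g (p j) x y
    (f' (p j)) eta k D) => //; rewrite ?eta0 ?sideN//.
  by apply: h2.
- exact: etaD.
- apply: (@le_lt_trans _ _ (theta / 2)); last by lra.
  apply: le_trans etaLam.
  have cardJ : #|{: J * bool}|%:R <= 2 * (Lam / sg + n%:R) :> R.
    rewrite card_prod card_bool natrM mulrC ler_pM2l// card_tagged.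
    rewrite sumnE big_map big_enum /= natr_sum.
    apply: (@le_trans _ _ (\sum_(i < n) (len i / sg + 1))).
      apply: ler_sum => i _; rewrite card_ord /N -natr1 lerD2r.
      by have /trunc_itv/andP[] : 0 <= len i / sg by rewrite divr_ge0 ?len0// ltW.
    rewrite big_split /= -mulr_suml sumr_const card_ord lerD2r.
    by rewrite ler_pM2r ?invr_gt0.
  apply: (@le_trans _ _ (2 * (Lam / sg + n%:R) * (2 * eta * D))).
    by rewrite ler_wpM2r.
  have -> : 2 * (Lam / sg + n%:R) * (2 * eta * D) =
      16 * eta * (Lam + n%:R * sg) / eps.
    by rewrite /D; field; rewrite !gt_eqF.
  rewrite ler_pM2r ?invr_gt0// ler_pM2l ?mulr_gt0//; lra.
apply: le_lt_trans HS; apply: le_H1 => x [Ex nP]; split => // -[i /= ni Si].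
apply: nP; have /andP[hx0 hxl] := h3 _ _ ni Si.
have hsg0 : 0 <= h i x / sg by rewrite divr_ge0// ltW.
have cN : (Num.trunc (h i x / sg) < N i)%N.
  by rewrite /N ltnS; apply: le_truncn; rewrite ler_pM2r ?invr_gt0.
pose j0 : J := Tagged (fun i : 'I_n => 'I_(N i)) (i := Ordinal ni) (Ordinal cN).
have cellx : cell j0 x by split => //=; exact: trunc_itv.
have Pj0 : P j0 by apply/asboolP; exists x.
have [Sp0 /= /andP[hp1 hp2]] := pP _ Pj0.
have /andP[hx1 hx2] := trunc_itv hsg0.
have hxp : `|h i x - h i (p j0)| <= sg.
  rewrite ltr_pdivrMr// in hp2; rewrite ltr_pdivrMr// in hx2.
  rewrite ler_pdivlMr// in hp1; rewrite ler_pdivlMr// in hx1.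
  rewrite -natr1 mulrDl mul1r in hp2; rewrite -natr1 mulrDl mul1r in hx2.
  by rewrite ler_norml; apply/andP; split; lra.
have dxp : d x (p j0) <= 2 * sg.
  have := h2 _ _ _ Si Sp0; have := metric_ge0 hd x (p j0) => a b.
  have : (1 / 2) * d x (p j0) <= (1 - eta) * d x (p j0).
    by rewrite ler_wpM2r//; lra.
  by move: b hxp => /=; lra.
have gx4 : g x <= f' x + 4 * sg.
  apply: (le_trans (guj j0 x Pj0)); rewrite /u.
  have := f'tri (p j0) x; rewrite (metric_sym hd (p j0)).
  have := metric_ge0 hd x (p j0) => a b.
  by have := mulr_ge0 (ltW eps0) a; lra.
case: (gatt x) => [gx|[j Pj gx]]; first by move: gx4; rewrite gx /u0; lra.
have [Sp _] := pP _ Pj.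
have dxD : d x (p j) <= D.
  rewrite /D ler_pdivlMr//; have := gx4; rewrite gx /u; have := f'tri x (p j).
  by lra.
(* Different pieces are at distance at least [rho], which exceeds [D]. *)
have ij : tag j = i :> nat.
  apply: contrapT => ij; have ij' : i <> tag j by move=> h'; apply: ij.
  by have := sep _ _ _ _ ij' Si Sp; rewrite /D in dxD; lra.
exists (j, h (tag j) (p j) <= h (tag j) x) => //; split => //=.
  by rewrite ij.
rewrite /side; case: ifP; first by rewrite !mul1r.
by move=> /negbT; rewrite -ltNge !mulN1r lerN2 => /ltW.
Qed.

End Density.

(** * Lebesgue measure and density points on the line *)

Section LebesgueHausdorff.
Variable R : realType.
Local Notation leb := (@lebesgue_measure R).

(** For arbitrary [M], [leb M] is an infimum over covers by half-open intervals. *)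
Lemma H1_le_lebesgue (M : set R) : (H1 (@dR R) M <= leb M)%E.
Proof.
apply: le_ereal_inf_tmp => _ [C [mC MC] <-].
apply: (le_trans (H1_sub_bigcup_le (@dR R) MC)).
apply: lee_nneseries => [i _ _|i _]; first exact: H1_ge0.
have [[a b] _ /= <-] := mC i.
have [ab|ba] := ltP a b.
  rewrite wlength_itv_bnd ?(ltW ab)//=.
  apply: H1_interval; first exact: ltW.
  by move=> x; rewrite /= in_itv /= => /andP[/ltW -> ->].
by rewrite set_itv_ge ?H1_set0 ?wlength0// bnd_simp -leNgt.
Qed.

(** Each member of a cover lies in a closed interval, starting at its infimum, of length its
    diameter. *)
Lemma lebesgue_le_H1 (M : set R) : measurable M -> (leb M <= H1 (@dR R) M)%E.
Proof.
move=> mM; have [->|Mfin] := eqVneq (H1 (@dR R) M) +oo%E; first by rewrite leey.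
have {}Mfin : (H1 (@dR R) M < +oo)%E by rewrite ltey.
apply/lee_addgt0Pr => e e0.
have [C [MC Cd Cs]] := H1_cover ltr01 e0 Mfin.
apply: le_trans Cs.
have /choice[a ha] : forall i, exists a, C i `<=` `[a, a + fine (diam (@dR R) (C i))]%classic.
  move=> i; have Df : diam (@dR R) (C i) \is a fin_num.
    by rewrite ge0_fin_numE ?diam_ge0//; apply: le_lt_trans (Cd i) _; rewrite ltry.
  have diff x y : C i x -> C i y -> `|x - y| <= fine (diam (@dR R) (C i)).
    by move=> Cx Cy; rewrite -lee_fin fineK//; exact: (le_diam (@dR R) Cx Cy).
  have [[x0 Cx0]|nC] := pselect (exists x, C i x); last first.
    by exists 0 => x Cx; exfalso; apply: nC; exists x.
  have lb x : C i x -> lbound (C i) (x - fine (diam (@dR R) (C i))).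
    move=> Cx y Cy; have := diff _ _ Cx Cy; rewrite ler_norml => /andP[_].
    by lra.
  exists (inf (C i)) => x Cx; rewrite /= in_itv /=; apply/andP; split.
    by apply: ge_inf => //; exists (x0 - fine (diam (@dR R) (C i))); exact: lb.
  rewrite -lerBlDr; apply: lb_le_inf; first by exists x0.
  exact: lb.
pose B i : set R := `[a i, a i + fine (diam (@dR R) (C i))]%classic.
apply: (@le_trans _ _ (\sum_(0 <= i <oo) leb (B i))%E).
  apply: measure_sigma_subadditive => //; first by move=> i; rewrite /B.
  move=> x /MC[i _ Ci].
  by exists i => //; exact: ha.
apply: lee_nneseries => // i _.
have Df : diam (@dR R) (C i) \is a fin_num.
  by rewrite ge0_fin_numE ?diam_ge0//; apply: le_lt_trans (Cd i) _; rewrite ltry.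
rewrite /B lebesgue_measure_itv /= lte_fin; case: ifP => _; last exact: diam_ge0.
by rewrite -EFinB addrAC subrr add0r fineK.
Qed.

Lemma H1_interval_ge (u s : R) : 0 < s ->
  ((2 * s)%:E <= H1 (@dR R) [set v | (`|v - u| < s)%R])%E.
Proof.
move=> s0; have -> : [set v | `|v - u| < s] = ball u s :> set R.
  by apply/seteqP; split => v; rewrite /ball /= distrC.
apply: (le_trans _ (lebesgue_le_H1 (measurable_realfun.measurable_ball _ _))).
by rewrite lebesgue_measure_ball ?(ltW s0)// lee_fin mulr2n; lra.
Qed.

(** Normalized by [r] and measured by [H1], as in [approx_deriv]. *)
Definition line_density_point (F : set R) (u : R) : Prop :=
  forall eps, 0 < eps -> exists delta, 0 < delta /\ forall r, 0 < r -> r < delta ->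
    (H1 (@dR R) (~` F `&` [set v | (`|v - u| < r)%R]) <= (eps * r)%:E)%E.

Lemma ae_line_density_point (F : set R) : measurable F ->
  exists N : set R, H1 (@dR R) N = 0%E /\
    forall u, F u -> ~ N u -> line_density_point F u.
Proof.
move=> mF; have [N [mN N0 NP]] := lebesgue_density (measurableC mF).
exists N; split.
  by apply/eqP; rewrite eq_le H1_ge0 andbT -N0; exact: H1_le_lebesgue.
move=> u Fu nNu eps eps0.
have cvg : (leb (~` F `&` ball u r) * (leb (ball u r))^-1)%E @[r --> 0^'+] --> 0%E.
  have := contra_notP (@NP u) nNu; rewrite /= indicE memNset//; exact.
have [delta /= delta0 hd] : \forall r \near 0^'+,
    (leb (~` F `&` ball u r) * (leb (ball u r))^-1 < (eps / 2)%:E)%E.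
  apply: (cvg [set x | (x < (eps / 2)%:E)%E]); apply: open_ereal_lt'.
  by rewrite lte_fin divr_gt0.
exists delta; split => // r r0 rd.
have -> : [set v | `|v - u| < r] = ball u r :> set R.
  by apply/seteqP; split => v; rewrite /ball /= distrC.
apply: (le_trans (H1_le_lebesgue _)).
have := hd r; rewrite /ball /= sub0r normrN gtr0_norm// => /(_ rd r0).
rewrite -/(ball u r) lebesgue_measure_ball ?(ltW r0)//.
rewrite inver mulrn_eq0/= gt_eqF// lte_pdivrMr ?mulrn_wgt0// => /ltW h.
apply: (le_trans h); rewrite -EFinM lee_fin -(mulr_natr r); lra.
Qed.

End LebesgueHausdorff.

(** * Asymptotically isometric pieces and the density of the rest of the set *)

Section PieceDefinitions.
Variables (R : realType) (X : Type) (d : X -> X -> R).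

Definition asymptotically_isometric (g : X -> R) (S : set X) : Prop :=
  forall eps, 0 < eps -> exists rho, 0 < rho /\ forall x y, S x -> S y ->
    d x y < rho -> (1 - eps) * d x y <= `|g x - g y|.

Definition thin_at (E S : set X) (x : X) : Prop := forall eps, 0 < eps ->
  exists delta, 0 < delta /\ forall r, 0 < r -> r < delta ->
    (H1 d ((E `\` S) `&` mball d x r) <= (eps * r)%:E)%E.

End PieceDefinitions.

Section IsometricPieces.
Variables (R : realType) (disp : measure_display) (X : measurableType disp).
Variables (d : X -> X -> R) (mu : {measure set X -> \bar R}).
Hypothesis hmeas : forall A : set X, measurable A <-> H1_measurable d A.
Hypothesis hmu : forall A : set X, measurable A -> mu A = H1 d A.
Hypothesis hd : is_metric d.
Variables (E : set X) (g : X -> R).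
Hypothesis mE : measurable E.
Hypothesis Efin : (H1 d E < +oo)%E.
Hypothesis gL : forall x y, `|g x - g y| <= d x y.

Hypothesis gexp : forall lam : R, 0 < lam -> exists G : nat -> set X,
  (forall i x y, G i x -> G i y -> (1 - lam) * d x y <= `|g x - g y|) /\
  H1 d (E `\` \bigcup_i G i) = 0%E.

Lemma closed_expanding (lam : R) : 0 < lam <= 1 -> exists C : nat -> set X,
  [/\ forall i, mclosed d (C i),
      forall i x y, C i x -> C i y -> (1 - lam) * d x y <= `|g x - g y| &
      H1 d (E `\` \bigcup_i C i) = 0%E].
Proof.
move=> /andP[lam0 lam1]; have [G [hG G0]] := gexp lam0.
(* With [n = 0] the conditions on lengths are void, and [family_closure] just carries the expansion
   over to closures. *)
have fam : almost_isometric_family d lam 0 G (fun=> g) (fun=> 0) by split.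
have lam01 : 0 <= lam <= 1 by rewrite ltW.
have [_ hC _ _] := family_closure hd lam01 fam.
exists (fun i => mclosure d (G i)); split => //.
  by move=> i; exact: mclosure_closed.
apply: H1_null_sub G0 => x [Ex nC]; split => // -[i _ Gi]; apply: nC.
by exists i => //; exact: sub_mclosure.
Qed.

Lemma mclosed_finite_union (T : nat -> set X) n : (forall i, mclosed d (T i)) ->
  mclosed d (\bigcup_(i < n) T i).
Proof.
move=> cT; elim: n => [|n ih].
  by move=> x /(_ 1 ltr01)[y [i]].
have -> : \bigcup_(i < n.+1) T i = (\bigcup_(i < n) T i) `|` T n.
  by rewrite !bigcup_mkord big_ord_recr.
exact: mclosedU.
Qed.

(** Finitely many closed expanding sets are made uniformly separated; two points closer than the gap
    lie in the same one. *)
Lemma locally_expanding_part (eps kap : R) : 0 < eps -> 0 < kap ->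
  exists T rho, [/\ mclosed d T, 0 < rho, (H1 d (E `\` T) < kap%:E)%E &
    forall x y, T x -> T y -> d x y < rho -> (1 - eps) * d x y <= `|g x - g y|].
Proof.
move=> eps0 kap0; pose lam := Num.min eps 1.
have lam01 : 0 < lam <= 1 by rewrite lt_min eps0 ltr01 ge_min lexx orbT.
have [C [cC hC C0]] := closed_expanding lam01.
have kap2 : 0 < kap / 2 by lra.
have [||n Hn] := @H1_exhaust _ _ _ _ _ hmu E (E `\` \bigcup_i C i) C (kap / 2)
    mE Efin C0 _ _ kap2.
- by move=> n; exact: (mclosed_measurable hmeas hd).
- by move=> x Ex; have [|nC] := pselect ((\bigcup_i C i) x); [right|left].
have [T [rho [rho0 [cT TC Tsep HT]]]] :=
  @separated_exhaust _ _ _ _ _ hmeas hmu hd E C n _ mE Efin cC kap2.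
exists (\bigcup_(i < n) T i), rho; split => //.
- exact: mclosed_finite_union.
- apply: (@le_lt_trans _ _ (H1 d (E `\` \bigcup_(i < n) C i) +
    H1 d ((E `&` \bigcup_(i < n) C i) `\` \bigcup_(i < n) T i))%E).
    apply: H1_sub_le => x [Ex nT].
    by have [|nC] := pselect ((\bigcup_(i < n) C i) x); [right|left].
  have -> : kap%:E = ((kap / 2)%:E + (kap / 2)%:E)%E.
    by rewrite -EFinD; congr EFin; lra.
  exact: lteD.
- move=> x y [i _ Ti] [j _ Tj] xy.
  have [ij|/eqP ij] := eqVneq i j; last first.
    by have := Tsep _ _ _ _ ij Ti Tj; rewrite leNgt xy.
  rewrite -ij in Tj; apply: le_trans (hC i _ _ (TC _ _ Ti) (TC _ _ Tj)).
  rewrite ler_wpM2r ?(metric_ge0 hd)// lerD2l lerN2 ge_min lexx//.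
Qed.

(** The locally expanding parts for all [eps = k.+1%:R^-1] are intersected, with summable losses. *)
Lemma isometric_core (kap : R) : 0 < kap -> exists K,
  [/\ mclosed d K, K `<=` E, asymptotically_isometric d g K &
      (H1 d (E `\` K) <= kap%:E)%E].
Proof.
move=> kap0; have kap2 : 0 < kap / 2 by lra.
have [K0 [cK0 K0E HK0]] := inner_regular hmeas hmu hd mE Efin kap2.
have /choice[T hT] : forall k : nat, exists T, [/\ mclosed d T,
    (H1 d (E `\` T) < (kap / 2 / (2 ^ k.+1)%:R)%:E)%E & exists rho, 0 < rho /\
    forall x y, T x -> T y -> d x y < rho ->
      (1 - k.+1%:R^-1) * d x y <= `|g x - g y|].
  move=> k; have [||T [rho [cT rho0 HT Tx]]] :=
    @locally_expanding_part k.+1%:R^-1 (kap / 2 / (2 ^ k.+1)%:R).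
  - exact: natSinv_gt0.
  - by rewrite divr_gt0// ltr0n expn_gt0.
  - by exists T; split => //; exists rho.
exists (K0 `&` \bigcap_k T k); split.
- by apply: mclosedI => //; apply: mclosed_bigcap => k; case: (hT k).
- by move=> x [/K0E].
- move=> eps eps0; have [k ke] := ex_natSinv_lt eps0.
  have [_ _ [rho [rho0 h]]] := hT k; exists rho; split => // x y [_ Tx] [_ Ty] xy.
  apply: le_trans (h x y (Tx k I) (Ty k I) xy).
  by rewrite ler_wpM2r ?(metric_ge0 hd)// lerD2l lerN2 ltW.
- apply: (@le_trans _ _ (H1 d (E `\` K0) + H1 d (\bigcup_k (E `\` T k)))%E).
    apply: H1_sub_le => x [Ex nK]; have [Kx|] := pselect (K0 x); last by left.
    right; apply: contrapT => nT; apply: nK; split => // k _.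
    by apply: contrapT => nTk; apply: nT; exists k.
  have -> : kap%:E = ((kap / 2)%:E + (kap / 2)%:E)%E.
    by rewrite -EFinD; congr EFin; lra.
  apply: leeD; first exact: ltW.
  apply: (le_trans (H1_bigcup_le _ _)); apply: nneseries_le_half => //.
    by move=> k; exact: H1_ge0.
  by move=> k; have [_ h _] := hT k; exact: ltW.
Qed.

(** Asymptotic isometry is only local; intersecting the cores with sets that expand by [2^-1] adds
    the global bound that makes [g] injective on each piece. *)
Lemma isometric_pieces : exists S : nat -> set X, (forall i,
    [/\ mclosed d (S i), S i `<=` E, asymptotically_isometric d g (S i) &
        forall x y, S i x -> S i y -> d x y <= 2 * `|g x - g y|]) /\
  H1 d (E `\` \bigcup_i S i) = 0%E.
Proof.
have /choice[K hK] : forall m : nat, exists K,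
    [/\ mclosed d K, K `<=` E, asymptotically_isometric d g K &
      (H1 d (E `\` K) <= (m.+1%:R^-1)%:E)%E].
  by move=> m; apply: isometric_core; exact: natSinv_gt0.
have half01 : 0 < (2^-1 : R) <= 1 by apply/andP; split; lra.
have [C [cC hC C0]] := closed_expanding half01.
have /card_esym/ppcard_eqP[f] := card_nat2.
exists (fun i => K (f i).1 `&` C (f i).2); split.
  move=> i; have [cK KE aK _] := hK (f i).1; split.
  - exact: mclosedI.
  - by move=> x [/KE].
  - move=> eps /aK[rho [rho0 h]]; exists rho; split => // x y [Kx _] [Ky _].
    exact: h.
  - by move=> x y [_ Cx] [_ Cy]; have := hC _ _ _ Cx Cy; lra.
apply: H1_nullP => e e0; have [m me] := ex_natSinv_lt e0.
have [_ _ _ Hm] := hK m.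
apply: (@le_trans _ _ (H1 d (E `\` K m) + H1 d (E `\` \bigcup_i C i))%E).
  apply: H1_sub_le => x [Ex nS]; have [Kx|] := pselect (K m x); last by left.
  right; split => // -[i _ Ci]; apply: nS.
  by exists (f^-1%FUN (m, i)) => //=; rewrite invK ?inE.
by rewrite C0 adde0; apply: (le_trans Hm); rewrite lee_fin ltW.
Qed.

Section Piece.
Variable S : set X.
Hypothesis cS : mclosed d S.
Hypothesis gS : forall x y, S x -> S y -> d x y <= 2 * `|g x - g y|.

(** The covering argument takes place on the line: as [g] is [1]-Lipschitz, disjoint intervals
    around values of [g] come from disjoint balls. By [gS] the part of [S] over an interval enlarged
    five times has measure at most [20 * rho k], while the ball carries more than [t * rho k] of the
    rest of [E]. *)
Let thick_null (t : R) : 0 < t ->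
  H1 d [set x | S x /\ forall delta, 0 < delta -> exists r, [/\ 0 < r, r < delta &
    ((t * r)%:E < H1 d ((E `\` S) `&` mball d x r))%E]] = 0%E.
Proof.
move=> t0; set B := [set x | _]; apply: H1_nullP => e e0.
pose kap := e * t / 20; have kap0 : 0 < kap by rewrite divr_gt0// mulr_gt0.
have mS : measurable S by exact: (mclosed_measurable hmeas hd).
(* Small balls centred in [S] meet the rest of [E] only near [S]; as [S] is closed, the measure of
   this part tends to [0]. *)
pose A n := (E `\` S) `\` far d S n.
have [n hn] : exists n, (H1 d (A n) < kap%:E)%E.
  apply: (H1_nonincreasing_lt hmu) => //.
  - move=> n; apply: measurableD; first exact: measurableD.
    by apply: (mclosed_measurable hmeas hd); exact: far_closed.
  - by move=> m n mn x [ESx h]; split => // fm; apply: h; exact: far_mono fm.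
  - by apply: le_lt_trans Efin; apply: le_H1 => x [[]].
  - rewrite (_ : \bigcap_i _ = set0) ?H1_set0// -subset0 => x h.
    have [[_ nS] _] := h 0%N I; have [m fm] := mclosedN cS nS.
    by have [_] := h m I.
pose V := [set p : R * R | 0 < p.2 <= n.+1%:R^-1 /\ exists x, [/\ S x, g x = p.1 &
  ((t * p.2)%:E < H1 d ((E `\` S) `&` mball d x p.2))%E]].
have [|J [c [rho [JV Jdisj Jcov]]]] := @vitali_sequence R V n.+1%:R^-1.
  by move=> p [].
have [[x0 Sx0]|noS] := pselect (exists x, S x); last first.
  rewrite (_ : B = set0) ?H1_set0 ?lee_fin ?(ltW e0)//.
  by rewrite -subset0 => x [Sx _]; apply: noS; exists x.
have /choice[q hq] : forall k, exists x, J k -> [/\ S x, g x = c k &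
  ((t * rho k)%:E < H1 d ((E `\` S) `&` mball d x (rho k)))%E].
  move=> k; have [Jk|nJ] := pselect (J k); last by exists x0.
  by have [_ [x hx]] := JV _ Jk; exists x.
pose M k := [set z | J k /\ ((E `\` S) `&` mball d (q k) (rho k)) z].
have mM k : measurable (M k).
  have [Jk|nJ] := pselect (J k).
    rewrite (_ : M k = (E `\` S) `&` mball d (q k) (rho k)).
      by apply: measurableI; [exact: measurableD|exact: (mball_measurable hmeas hd)].
    by apply/seteqP; split => z; [case|split].
  by rewrite (_ : M k = set0)// -subset0 => z [].
have tM : trivIset setT M.
  move=> i j _ _ [z [[Ji [_ zi]] [Jj [_ zj]]]].
  have [_ gi _] := hq _ Ji; have [_ gj _] := hq _ Jj.
  apply: (Jdisj _ _ (g z)) => //; rewrite distrC.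
    by rewrite -gi; apply: le_lt_trans (gL _ _) zi.
  by rewrite -gj; apply: le_lt_trans (gL _ _) zj.
pose U k := [set x | J k /\ S x /\ `|g x - c k| <= 5 * rho k].
have Uk k : (H1 d (U k) <= (20 / t)%:E * mu (M k))%E.
  have t20 : (0 <= (20 / t)%:E)%E by rewrite lee_fin divr_ge0// ltW.
  have [Jk|nJ] := pselect (J k); last first.
    rewrite (_ : U k = set0); last by rewrite -subset0 => z [].
    by rewrite H1_set0 mule_ge0.
  have [/andP[rk0 _] _] := JV _ Jk; rewrite /= in rk0.
  have [_ _ hk] := hq _ Jk.
  apply: (@le_trans _ _ ((20 / t)%:E * (t * rho k)%:E)%E); last first.
    rewrite lee_wpmul2l// hmu//; apply: le_trans (ltW hk) _.
    by apply: le_H1 => z hz; split.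
  have -> : ((20 / t)%:E * (t * rho k)%:E = (2 * ((c k + 5 * rho k) - (c k - 5 * rho k)))%:E)%E.
    by rewrite -EFinM; congr EFin; field; rewrite gt_eqF.
  rewrite -[U k]image_id; apply: (@H1_image_interval _ _ _ _ _ _ g) => //; first lra.
    by move=> x y [_ [Sx _]] [_ [Sy _]]; exact: gS.
  by move=> x [_ [_]]; rewrite ler_norml => /andP[? ?]; apply/andP; split; lra.
have cover : B `<=` \bigcup_k U k.
  move=> x [Sx /(_ _ (natSinv_gt0 R n))[r [r0 rn hr]]].
  have [||k Jk xk] := Jcov (g x, r) (g x).
  - by split; [rewrite r0 ltW|exists x].
  - by rewrite subrr normr0 ltW.
  - by exists k.
apply: (le_trans (H1_sub_bigcup_le d cover)).
apply: (@le_trans _ _ (\sum_(0 <= k <oo) ((20 / t)%:E * mu (M k)))%E).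
  by apply: lee_nneseries => // k _ _; exact: H1_ge0.
rewrite nneseriesZl// (series_measure_bigcup mu mM tM).
have -> : e%:E = ((20 / t)%:E * kap%:E)%E.
  by rewrite -EFinM; congr EFin; rewrite /kap; field; rewrite gt_eqF.
rewrite lee_wpmul2l ?lee_fin ?divr_ge0 ?(ltW t0)//.
rewrite hmu; last exact: bigcupT_measurable.
apply: le_trans (ltW hn); apply: le_H1 => z [k _ [Jk [ESz zk]]].
split => // fz; have [/andP[_ rn] _] := JV _ Jk; have [Sq _ _] := hq _ Jk.
have := fz _ Sq; rewrite leNgt metric_sym// => /negP; apply.
exact: lt_le_trans zk rn.
Qed.

Lemma ae_thin : H1 d [set x | S x /\ ~ thin_at d E S x] = 0%E.
Proof.
pose B n := [set x | S x /\ forall delta, 0 < delta -> exists r, [/\ 0 < r, r < delta &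
    ((n.+1%:R^-1 * r)%:E < H1 d ((E `\` S) `&` mball d x r))%E]].
apply: (@H1_null_sub _ _ _ _ (\bigcup_n B n)); last first.
  by apply: H1_null_bigcup => n; apply: thick_null; exact: natSinv_gt0.
move=> x [Sx /existsNP[eps /not_implyP[eps0 neps]]].
have [n ne] := ex_natSinv_lt eps0; exists n => //; split => // delta delta0.
apply: contrapT => /forallNP h; apply: neps; exists delta; split => // r r0 rd.
rewrite leNgt; apply/negP => hr; apply: (h r); split => //.
by apply: le_lt_trans hr; rewrite lee_fin ler_pM2r// ltW.
Qed.

End Piece.
End IsometricPieces.

(** * The Jacobian at a good point of a piece *)

Section PointwiseJacobian.
Variables (R : realType) (X : Type) (d : X -> X -> R).
Hypothesis hd : is_metric d.
Variables (g : X -> R) (S : set X).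
Hypothesis gL : forall x y, `|g x - g y| <= d x y.
Hypothesis gS : forall x y, S x -> S y -> d x y <= 2 * `|g x - g y|.

Lemma piece_inj x y : S x -> S y -> g x = g y -> x = y.
Proof.
move=> Sx Sy gxy; apply: (metric_eq0 hd); apply/eqP.
rewrite eq_le (metric_ge0 hd) andbT; apply: (le_trans (gS Sx Sy)).
by rewrite gxy subrr normr0 mulr0.
Qed.

(** By [gS], preimages in [S] of a convergent sequence form a Cauchy sequence. Closedness makes the
    image measurable, so that Lebesgue density applies to it. *)
Lemma image_closed : complete_metric d -> mclosed d S -> closed (g @` S).
Proof.
move=> cX cS v clv.
have /choice[y hy] : forall n : nat, exists y, S y /\ `|g y - v| < n.+1%:R^-1.
  move=> n; have [_ [[y Sy <-] vy]] := clv _ (nbhsx_ballx v _ (natSinv_gt0 R n)).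
  by exists y; split => //; rewrite distrC.
have [|l hl] := cX y.
  move=> e e0; have [N Ne] := @ex_natSinv_lt R (e / 4) ltac:(lra).
  exists N => m n Nm Nn; have [Sm gm] := hy m; have [Sn gn] := hy n.
  apply: (le_lt_trans (gS Sm Sn)).
  have := ler_distD v (g (y m)) (g (y n)); rewrite (distrC v).
  have := natSinv_le R Nm; have := natSinv_le R Nn.
  move: Ne gm gn; move: (N.+1%:R^-1 : R) (m.+1%:R^-1 : R) (n.+1%:R^-1 : R) => a b c.
  by lra.
have Sl : S l.
  apply: cS => e e0; have [N hN] := hl _ e0; exists (y N); first by case: (hy N).
  by rewrite metric_sym//; exact: hN.
exists l => //; apply/eqP; rewrite -subr_eq0 -normr_le0; apply/ler_addgt0Pr => e e0.
rewrite add0r; have [N Ne] := @ex_natSinv_lt R (e / 2) ltac:(lra).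
have [N' hN'] := hl (e / 2) ltac:(lra); pose m := maxn N N'.
have [_ gm] := hy m; have := hN' m (leq_maxr _ _).
have := natSinv_le R (leq_maxl N N' : (N <= m)%N).
have := ler_distD (g (y m)) (g l) v; have := gL l (y m); rewrite (metric_sym hd l).
move: Ne gm; move: (N.+1%:R^-1 : R) (m.+1%:R^-1 : R) => a b; lra.
Qed.

Section Point.
Variable x : X.
Hypothesis Sx : S x.
Hypothesis aS : asymptotically_isometric d g S.
Hypothesis dS : line_density_point (g @` S) (g x).

(** The image of [S] nearly fills the interval of radius [(1 - e) * r] around [g x]; its preimage
    lies in the ball of radius [r], and [g] does not increase [H1]. *)
Lemma piece_density_lower (e : R) : 0 < e < 1 -> exists delta, 0 < delta /\
  forall r, 0 < r -> r < delta ->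
  (((2 - e) * ((1 - e) * r))%:E <= H1 d (S `&` [set y | (d x y < r)%R]))%E.
Proof.
move=> /andP[e0 e1]; have [rho [rho0 hrho]] := aS e0.
have [de [de0 hde]] := dS e0.
exists (Num.min (rho / 2) de); split; first by rewrite lt_min divr_gt0.
move=> r r0; rewrite lt_min => /andP[rrho rde].
pose s := (1 - e) * r; have s0 : 0 < s by rewrite mulr_gt0// subr_gt0.
have sr : s < r by rewrite /s gtr_pMl//; lra.
have hs := hde s s0 (lt_trans sr rde).
pose A := S `&` [set y | d x y < r].
have : (H1 (@dR R) [set v | (`|v - g x| < s)%R] <= (e * s)%:E + H1 d A)%E.
  apply: (@le_trans _ _ (H1 (@dR R) (~` (g @` S) `&` [set v | (`|v - g x| < s)%R]) +
    H1 (@dR R) (g @` A))%E).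
    apply: H1_sub_le => v vs; have [[y Sy yv]|nF] := pselect ((g @` S) v); last by left.
    right; exists y => //; split => //=; rewrite -yv /= in vs.
    have xy := gS Sx Sy; rewrite distrC in xy.
    have := hrho x y Sx Sy; rewrite (distrC (g x)) => hxy.
    have {}hxy : (1 - e) * d x y <= `|g y - g x| by apply: hxy; lra.
    by rewrite -(ltr_pM2l (_ : 0 < 1 - e)) ?subr_gt0//; exact: le_lt_trans hxy vs.
  apply: leeD => //.
  have := @H1_lip_image R X R X (@dR R) d A g id 1 ltr01.
  rewrite image_id mul1e; apply => a b _ _; rewrite mul1r; exact: gL.
move=> h; have := le_trans (H1_interval_ge (g x) s0) h.
have -> : (2 * s)%:E = ((e * s)%:E + ((2 - e) * s)%:E)%E.
  by rewrite -EFinD; congr EFin; lra.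
by rewrite leeD2lE.
Qed.

Lemma piece_density_upper (e : R) : 0 < e -> exists delta, 0 < delta /\
  forall r, 0 < r -> r < delta ->
  (H1 d (S `&` [set y | (d x y < r)%R]) <= ((2 + e) * r)%:E)%E.
Proof.
(* Chosen so that the inverse of [g] on [S] is locally [(2 + e) / 2]-Lipschitz. *)
move=> e0; pose e' := e / (2 + e).
have e2 : 0 < 2 + e by lra.
have e'0 : 0 < e' by rewrite divr_gt0.
have e'E : (2 + e) / 2 * (1 - e') = 1 by rewrite /e'; field; rewrite gt_eqF.
have [rho [rho0 hrho]] := aS e'0.
exists (rho / 2); split; first by rewrite divr_gt0.
move=> r r0 rrho; set A := S `&` _; rewrite -[A]image_id.
have -> : (2 + e) * r = (2 + e) / 2 * ((g x + r) - (g x - r)) by field.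
apply: (@H1_image_interval _ _ _ _ _ _ g); first by rewrite divr_gt0.
- by lra.
- move=> a b [Sa /= xa] [Sb /= xb].
  have ab := metric_tri hd x a b; rewrite (metric_sym hd a x) in ab.
  rewrite -[leLHS]mul1r -[X in X * d _ _]e'E -(mulrA ((2 + e) / 2)) ler_pM2l ?divr_gt0//.
  by apply: hrho => //; lra.
- move=> a [_ /= xa]; have := gL x a; rewrite ler_norml => /andP[? ?].
  by apply/andP; split; lra.
Qed.

Lemma piece_density_point : density_point d S x.
Proof.
(* [(2 - e) * (1 - e)] is at least [2 - 3 * e], hence at least [2 - eps]. *)
move=> eps eps0; pose e := Num.min (eps / 3) (1 / 2).
have e01 : 0 < e < 1.
  rewrite lt_min !divr_gt0//= gt_min; apply/orP; right; lra.
have [d1 [d10 h1]] := piece_density_lower e01.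
have [d2 [d20 h2]] := piece_density_upper eps0.
exists (Num.min d1 d2); split; first by rewrite lt_min d10.
move=> r r0; rewrite lt_min => /andP[rd1 rd2]; rewrite h2// andbT.
apply: le_trans (h1 r r0 rd1); rewrite lee_fin mulrA ler_pM2r//.
have : e <= eps / 3 by rewrite ge_min lexx.
by have := sqr_ge0 e; rewrite expr2; lra.
Qed.

Variable E : set X.
Hypothesis SE : S `<=` E.
Hypothesis thin : thin_at d E S x.

Let J := [set j : R | exists (F : set R) (Et : set X) (I : R -> X),
    biLip_bij d F Et I /\ Et `<=` E /\ density_point d Et x /\
    exists u : R, F u /\ I u = x /\
    exists D m : R, approx_deriv (g \o I) F u D /\ metric_deriv d I F u m /\
      0 < m /\ j = `|D| / m].

(* The piece is parametrized by the inverse of [g], for which both derivatives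
   equal [1]. *)
Lemma jacobian_witness : J 1.
Proof.
have /choice[I IP] : forall v, exists y, (g @` S) v -> S y /\ g y = v.
  move=> v; have [[y Sy yv]|nF] := pselect ((g @` S) v); last by exists x.
  by exists y.
have Ig y : S y -> I (g y) = y.
  move=> Sy; have [SI gI] : S (I (g y)) /\ g (I (g y)) = g y by apply: IP; exists y.
  exact: piece_inj.
exists (g @` S), S, I; split; last split; last split.
- split.
    apply/seteqP; split => [_ [v /IP[? _] <-]//|y Sy].
    by exists (g y); [exists y|exact: Ig].
  exists 2; split => // _ _ [y Sy <-] [z Sz <-]; rewrite !Ig//.
  split; last exact: gS.
  by have := gL y z; have := metric_ge0 hd y z; lra.
- exact: SE.
- exact: piece_density_point.
- exists (g x); split; first by exists x.
  split; first exact: Ig.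
  exists 1, 1; split; last split; last by split => //; rewrite normr1 divr1.
    move=> eps eps0; have [de [de0 h]] := dS eps0; exists de; split => // r r0 rd.
    apply: le_trans (h r r0 rd); apply: le_H1 => v [[nF|[Fv [vu bad]]] vr]; first by split.
    have [_ gIv] := IP _ Fv; exfalso; move: bad.
    rewrite /= gIv Ig// divff ?subrr ?normr0; last by rewrite subr_eq0; exact/eqP.
    by move=> /(lt_trans eps0); rewrite ltxx.
  move=> eps eps0; pose e' := eps / (2 + eps).
  have e2 : 0 < 2 + eps by lra.
  have e'0 : 0 < e' by rewrite divr_gt0.
  have e'E : (2 + eps) / 2 * (1 - e') = 1 by rewrite /e'; field; rewrite gt_eqF.
  have [rho [rho0 hrho]] := aS e'0.
  exists (rho / 2); split; first by rewrite divr_gt0.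
  move=> _ [y Sy <-] yx yxrho; rewrite !Ig//.
  have t0 : 0 < `|g y - g x| by rewrite normr_gt0 subr_eq0; exact/eqP.
  have yxd := gS Sy Sx; have yxg := gL y x.
  have h : d y x <= (2 + eps) / 2 * `|g y - g x|.
    rewrite -[leLHS]mul1r -[X in X * d _ _]e'E -(mulrA ((2 + eps) / 2)) ler_pM2l ?divr_gt0//.
    by apply: hrho => //; lra.
  rewrite ltr_norml; apply/andP; split.
    by rewrite ltrBrDr ltr_pdivlMr//; have := mulr_gt0 eps0 t0; lra.
  by rewrite ltrBlDr ltr_pdivrMr//; have := mulr_gt0 eps0 t0; lra.
Qed.

(** In a ball of radius [r], [Et] has measure at least [r], while its points outside [S] and those
    with a bad difference quotient take at most [r / 4] each. At a remaining point of [S] other than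
    [x], the quotient of [g] in the chart is close to [D] and, by asymptotic isometry, its size is
    close to [m]. *)
Lemma jacobian_unique j : J j -> j = 1.
Proof.
move=> [F [Et [I [[IF [L [L0 bil]]] [EtE [dens [u [Fu [Iu [D [m [aD [mD [m0 ->]]]]]]]]]]]]]].
(* One [e] comes from the quotient approximating [D], one from the metric derivative, and [e * m]
   from the factor [1 - e]. *)
suff close e : 0 < e -> e <= 1 -> `| `|D| - m| <= e * (m + 2).
  have -> : `|D| = m; last by rewrite divff// gt_eqF.
  apply/eqP; rewrite -subr_eq0 -normr_le0; apply/ler_addgt0Pr => e e0.
  rewrite add0r; have m2 : 0 < m + 2 by lra.
  pose e1 := Num.min 1 (e / (m + 2)).
  have : e1 * (m + 2) <= e.
    by rewrite -ler_pdivlMr// ge_min lexx orbT.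
  apply: le_trans; apply: close; first by rewrite lt_min ltr01 divr_gt0.
  by rewrite ge_min lexx.
(* Bad parameters within [L * r] of [u] have measure at most [ea * (L * r)], and [I] enlarges this
   by at most [L]; the result has to be at most [r / 4]. *)
move=> e0 e1; pose ea := Num.min e (1 / (4 * (L * L))).
have ea0 : 0 < ea by rewrite lt_min e0 divr_gt0 ?mulr_gt0.
have eae : ea <= e by rewrite ge_min lexx.
have eaL : L * L * ea <= 1 / 4.
  apply: (@le_trans _ _ (L * L * (1 / (4 * (L * L))))).
    by rewrite ler_pM2l ?mulr_gt0// ge_min lexx orbT.
  by rewrite le_eqVlt; apply/orP; left; apply/eqP; field; rewrite gt_eqF.
have [d1 [d10 hD]] := aD _ ea0.
have [d2 [d20 hm]] := mD _ e0.
have [d3 [d30 ht]] := thin (ltac:(lra) : 0 < 1 / 4).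
have [d4 [d40 hdens]] := dens _ ltr01.
have [d5 [d50 hrho]] := aS e0.
pose r := Num.min (Num.min (d1 / L) (d2 / L)) (Num.min d3 (Num.min d4 d5)) / 2.
have min0 : 0 < Num.min (Num.min (d1 / L) (d2 / L)) (Num.min d3 (Num.min d4 d5)).
  by rewrite !lt_min !divr_gt0// d30 d40 d50.
have r0 : 0 < r by rewrite divr_gt0.
have rlt : r < Num.min (Num.min (d1 / L) (d2 / L)) (Num.min d3 (Num.min d4 d5)).
  by rewrite /r; lra.
move: rlt; rewrite !lt_min !ltr_pdivlMr// => /andP[/andP[r1 r2] /and3P[r3 r4 r5]].
have Lr0 : 0 < L * r by rewrite mulr_gt0.
rewrite mulrC in r1; rewrite mulrC in r2.
pose Bad := ([set v | ~ F v] `|`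
  [set v | F v /\ v <> u /\ (ea < `|((g \o I) v - (g \o I) u) / (v - u) - D|)%R])
  `&` [set v | (`|v - u| < L * r)%R].
have [y [Sy [v [Fv vu Iv vr nbad]] xy]] : exists y, [/\ S y,
    (exists v, [/\ F v, v <> u, I v = y, `|v - u| < L * r & ~ Bad v]) & d x y < r].
  apply: contrapT => none.
  have Hlow := hdens r r0 r4; move: Hlow => /andP[Hlow _].
  have HI : (H1 d (I @` (F `&` Bad)) <= ((1 / 4) * r)%:E)%E.
    have lipI a b : (F `&` Bad) a -> (F `&` Bad) b ->
        d (I a) (I b) <= L * @dR R (id a) (id b).
      by move=> [Fa _] [Fb _]; have [_] := bil a b Fa Fb.
    apply: (le_trans (H1_lip_image L0 lipI)); rewrite image_id.
    apply: (@le_trans _ _ (L%:E * (ea * (L * r))%:E)%E).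
      rewrite lee_wpmul2l ?lee_fin ?(ltW L0)//; apply: le_trans (hD _ Lr0 r1).
      by apply: le_H1 => a [].
    rewrite -EFinM lee_fin; have := ler_wpM2r (ltW r0) eaL; lra.
  have : (H1 d (Et `&` [set y | (d x y < r)%R]) <=
      ((1 / 4) * r)%:E + (((1 / 4) * r)%:E + 0))%E.
    have sub : Et `&` [set y | (d x y < r)%R] `<=`
        ((E `\` S) `&` [set y | (d x y < r)%R]) `|` (I @` (F `&` Bad) `|` [set x]).
      move=> y [Ey xy]; have [Sy|nS] := pselect (S y); last first.
        by left; split => //; split => //; exact: EtE.
      right; have [v Fv vy] : (I @` F) y by rewrite IF.
      have [vu|vu] := pselect (v = u); first by right; rewrite /= -vy vu.
      left; exists v => //; split => //; apply: contrapT => nbad; apply: none.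
      exists y; split => //; exists v; split => //.
      have [h _] := bil v u Fv Fu; rewrite vy Iu ler_pdivrMr// in h.
      apply: (le_lt_trans h); rewrite mulrC ltr_pM2l// metric_sym//.
    apply: (le_trans (H1_sub_le d sub)); apply: leeD; first exact: ht.
    apply: (le_trans (H1U_le _ _ _)); apply: leeD => //.
    by rewrite (H1_null_dist0 hd)// => a b /= -> ->.
  move=> /(le_trans Hlow); rewrite adde0 -EFinD lee_fin.
  by lra.
have qD : `|(g y - g x) / (v - u) - D| <= ea.
  rewrite -Iv -Iu leNgt; apply/negP => h; apply: nbad; split => //.
  by right.
have mE := hm v Fv vu (lt_trans vr r2); rewrite Iv Iu in mE.
have yx := gL y x.
have hyx : (1 - e) * d y x <= `|g y - g x|.
  by apply: hrho => //; rewrite metric_sym//; exact: lt_trans xy r5.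
have t0 : 0 < `|v - u| by rewrite normr_gt0 subr_eq0; exact/eqP.
set m' := d y x / `|v - u| in mE; set q := (g y - g x) / (v - u) in qD.
have qE : `|q| = `|g y - g x| / `|v - u| by rewrite normrM normfV.
have qm : `|q| <= m' by rewrite qE /m' ler_pM2r ?invr_gt0.
have mq : (1 - e) * m' <= `|q| by rewrite qE /m' mulrA ler_pM2r ?invr_gt0.
have qD' : `| `|q| - `|D| | <= e.
  by apply: le_trans (ler_dist_dist _ _) _; exact: le_trans qD eae.
have m'm : (1 - e) * (m - e) <= (1 - e) * m'.
  by rewrite ler_wpM2l ?subr_ge0//; move: mE; rewrite ltr_norml => /andP[]; lra.
have em : 0 <= e * e by rewrite mulr_ge0// ltW.
have eme : 0 < e * m by rewrite mulr_gt0.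
move: mE qD'; rewrite ltr_norml ler_norml => /andP[? ?] /andP[? ?].
by rewrite ler_norml; apply/andP; split; lra.
Qed.

Lemma jacobian_eq1 : JE d E g x = 1.
Proof.
apply: jacobian_unique; apply: (@xgetPex _ 0 J); exists 1; exact: jacobian_witness.
Qed.

End Point.
End PointwiseJacobian.

(** * Functions in all the open sets *)

Section TypicalJacobian.
Variables (R : realType) (disp : measure_display) (X : measurableType disp).
Variables (d : X -> X -> R) (mu : {measure set X -> \bar R}).
Hypothesis hmeas : forall A : set X, measurable A <-> H1_measurable d A.
Hypothesis hmu : forall A : set X, measurable A -> mu A = H1 d A.
Hypothesis hd : is_metric d.
Hypothesis hcomplete : complete_metric d.
Variable E : set X.
Hypothesis mE : measurable E.
Hypothesis Efin : (H1 d E < +oo)%E.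

(** The exceptional set collects what the pieces miss, the points where the rest of [E] is not thin,
    and those whose value is not a density point of the image; the last are null since [f] has a
    [2]-Lipschitz inverse on each piece. *)
Lemma typical_jacobian (f : X -> R) : Lip1 d f ->
  (forall n : nat, nearly_unit_speed d E n.+1%:R^-1 f) ->
  exists Z, H1 d Z = 0%E /\ forall x, E x -> ~ Z x -> JE d E f x = 1.
Proof.
move=> [_ fL] fU.
have [S [hS S0]] := isometric_pieces hmeas hmu hd mE Efin fL
  (fun lam lam0 => expanding_exhaustion hd lam0 fU).
have /choice[N hN] : forall i, exists N : set R, H1 (@dR R) N = 0%E /\
    forall u, (f @` S i) u -> ~ N u -> line_density_point (f @` S i) u.
  move=> i; apply: ae_line_density_point; have [cS _ _ fS] := hS i.
  apply: measurable_realfun.closed_measurable.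
  by have := image_closed hd fL fS hcomplete cS.
pose thinN i := [set x | S i x /\ ~ thin_at d E (S i) x].
pose densN i := [set x | S i x /\ N i (f x)].
exists ((E `\` \bigcup_i S i) `|` \bigcup_i (thinN i `|` densN i)); split.
  apply/eqP; rewrite eq_le H1_ge0 andbT; apply: (le_trans (H1U_le _ _ _)).
  rewrite S0 add0e H1_null_bigcup// => i; have [cS _ _ fS] := hS i.
  apply/eqP; rewrite eq_le H1_ge0 andbT; apply: (le_trans (H1U_le _ _ _)).
  rewrite (ae_thin hmeas hmu hd mE Efin fL cS fS) add0e.
  rewrite -[densN i]image_id.
  apply: (@le_trans _ _ (2%:E * H1 (@dR R) (f @` densN i))%E).
    by apply: H1_lip_image => // x y [Sx _] [Sy _]; exact: fS.
  rewrite (@H1_null_sub _ _ _ _ (N i)) ?mule0//; first by move=> _ [x [_ Nx] <-].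
  by case: (hN i).
move=> x Ex nZ; have [[i _ Si]|nS] := pselect ((\bigcup_i S i) x); last first.
  by exfalso; apply: nZ; left.
have [_ SE aS fS] := hS i; have [_ hdens] := hN i.
apply: (jacobian_eq1 hd fL fS Si aS _ SE).
  apply: hdens; first by exists x.
  by move=> Nx; apply: nZ; right; exists i => //; right.
by apply: contrapT => nthin; apply: nZ; right; exists i => //; left.
Qed.

Lemma negligible_H1 (Z : set X) : H1 d Z = 0%E -> mu.-negligible Z.
Proof.
move=> Z0; have mZ : measurable Z by exact: null_measurable.
by apply/(negligibleP mu mZ); exact: etrans (hmu mZ) Z0.
Qed.

(** Measurability of [h] on [E] is not assumed: it follows because every subset of the null set [Z]
    is measurable. *)
Lemma integral_ae1 (h : X -> R) (Z : set X) : H1 d Z = 0%E ->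
  (forall x, E x -> ~ Z x -> h x = 1) ->
  (\int[mu]_(x in E) (h x)%:E)%E = H1 d E.
Proof.
move=> Z0 h1; have nullm A : A `<=` Z -> measurable A.
  by move=> AZ; apply: (null_measurable hmeas); exact: H1_null_sub AZ Z0.
have mZ : measurable Z by exact: nullm.
rewrite (@ae_eq_integral _ _ _ mu E (cst 1%E))//.
- by rewrite integral_cst// mul1e hmu.
- move=> _ Y mY.
  rewrite (_ : E `&` _ = (E `&` (fun x => (h x)%:E) @^-1` Y `&` Z) `|`
    ((E `\` Z) `&` [set _ | Y 1%E])); last first.
    apply/seteqP; split => x /=.
      move=> [Ex Yx]; have [Zx|nZ] := pselect (Z x); [by left|right].
      by split => //; rewrite -(h1 x).
    by move=> [[[]]//|[[Ex nZ] Y1]]; split => //; rewrite h1.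
  apply: measurableU; first by apply: nullm => x [].
  apply: measurableI; first exact: measurableD.
  have [Y1|nY] := pselect (Y 1%E).
    by rewrite (_ : [set _ | _] = setT)//; apply/seteqP; split.
  by rewrite (_ : [set _ | _] = set0)//; apply/seteqP; split.
- apply: negligibleS (negligible_H1 Z0) => x /= /not_implyP[Ex hx].
  by apply: contrapT => nZ; apply: hx; rewrite h1.
Qed.

End TypicalJacobian.

Unset Implicit Arguments. Set Strict Implicit. Set Printing Implicit Defensive.

Theorem theorem7p6 (R : realType) (disp : measure_display)
  (X : measurableType disp) (d : X -> X -> R)
  (mu : {measure set X -> \bar R})
  (hmeas : forall A : set X, measurable A <-> H1_measurable d A)
  (hmu : forall A : set X, measurable A -> mu A = H1 d A)
  (hd : is_metric d) (hcomplete : complete_metric d)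
  (E : set X) (hE : rectifiable1 d E) (hEfin : (H1 d E < +oo)%E) :
  residual_in_Lip1 d
    [set f | (\int[mu]_(x in E) (JE d E f x)%:E)%E = H1 d E] /\
  residual_in_Lip1 d
    [set f | {ae mu, forall x, E x -> JE d E f x = 1}].
Proof.
have mE : measurable E by apply/hmeas; case: hE.
have typical := typical_jacobian hmeas hmu hd hcomplete mE hEfin.
have UP n : open_in_Lip1 d (nearly_unit_speed d E n.+1%:R^-1) /\
    dense_in_Lip1 d (nearly_unit_speed d E n.+1%:R^-1).
  split; first exact: nearly_unit_speed_open.
  by apply: (nearly_unit_speed_dense hmeas hmu) => //; exact: natSinv_gt0.
split; exists (fun n => nearly_unit_speed d E n.+1%:R^-1); split => // f [fL fU].
  have [Z [Z0 fZ]] := typical f fL (fun n => fU n I).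
  exact: (integral_ae1 hmeas hmu mE Z0 fZ).
have [Z [Z0 fZ]] := typical f fL (fun n => fU n I).
apply: negligibleS (negligible_H1 hmeas hmu Z0) => x /= /not_implyP[Ex Jx].
by apply: contrapT => nZ; apply: Jx; exact: fZ.
Qed.
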